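(* For every $k\ge2$ there exists a polynomial $p_k$ of degree $2k-3$ such that, for all $n\ge 1$ and $0\le t<1/n$, $$\mathbb E S_k(t)=n\,p_k\Bigl(\frac1{1-nt}\Bigr)+O\Bigl(\frac{nt}{(1-nt)^{2k}}\Bigr)=n\,p_k\Bigl(\frac{1}{1-nt}\Bigr)\Bigl(1+O\Bigl(\frac{nt}{n(1-nt)^3}\Bigr)\Bigr).$$ Here $p_2(x)=x$, $p_3(x)=x^3$, $p_4(x)=3x^5-2x^4$; thus in particular $$\mathbb E S_3(t)=\frac{n}{(1-nt)^3}\Bigl(1+O\Bigl(\frac{nt}{n(1-nt)^3}\Bigr)\Bigr),\qquad \mathbb E S_4(t)=\frac{n\,(3-2(1-nt))}{(1-nt)^5}\Bigl(1+O\Bigl(\frac{nt}{n(1-nt)^3}\Bigr)\Bigr).$$ In general, for $k\ge3$, $p_k(x)=x^kq_k(x)$ for a polynomial $q_k(x)$ of degree $k-3$ that is recursively defined by $q_k(1)=1$ and $$q_k'(x)=\frac12\sum_{l=2}^{k-2}\binom kl q_{l+1}(x)\,q_{k-l+1}(x),\qquad k\ge3.$$ Equivalently, $p_k(1)=1$ and $$p_k'(x)=\frac1{2x^2}\sum_{l=1}^{k-1}\binom kl p_{l+1}(x)\,p_{k-l+1}(x),\qquad k\ge2.$$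
   Context: The random graph process $\mathcal G(n,t)$, $t\ge0$, starts at $t=0$ with $n$ vertices and no edges, and each of the $\binom n2$ possible edges is added independently at an exponentially distributed time with mean $1$; thus $\mathcal G(n,t)$ has the distribution of $G(n,1-e^{-t})$. For a graph $G$ with connected components $\mathcal C_1,\dots,\mathcal C_K$, $S_k(G)=\sum_{i=1}^K|\mathcal C_i|^k$, and $S_k(t)=S_k(\mathcal G(n,t))$. The constants implicit in $O$ may depend on $k$ but not on $n$ or $t$ in the given range. *)

(* Defs.v *)
From mathcomp Require Import all_boot all_order all_algebra.
From mathcomp Require Import all_classical all_reals all_analysis.
Import Order.TTheory GRing.Theory Num.Theory.

Set Implicit Arguments.
Unset Strict Implicit.
Unset Printing Implicit Defensive.

Local Open Scope ring_scope.

(* A graph on the vertex set V is given by its adjacency relation. *)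
Definition components (V : finType) (g : rel V) : {set {set V}} :=
  equivalence_partition (connect g) [set: V]%SET.

Definition S_ (V : finType) (k : nat) (g : rel V) : nat :=
  (\sum_(C in components g) #|C| ^ k)%N.

Definition edge (n : nat) : finType := {e : {set 'I_n} | #|e| == 2%N}.

Section Process.
Context (R : realType) (d : measure_display) (Omega : measurableType d).
Context (P : probability Omega R).

(* Mutual independence of a finite family: the product rule holds for every
   subfamily. *)
Definition mutually_independent (I : finType) (X : I -> {RV P >-> R}) : Prop :=
  forall (J : {set I}) (A : I -> set R), (forall i, measurable (A i)) ->
    P [set w | forall i, i \in J -> A i (X i w)]%classic =
    (\prod_(i in J) P (X i @^-1` A i)%classic)%E.

(* T e is the time at which the edge e is added; exponential_prob takes the
   rate as parameter, so that the mean is 1. *)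
Definition is_edge_times (n : nat) (T : edge n -> {RV P >-> R}) : Prop :=
  mutually_independent T /\
  forall (e : edge n) (A : set R), measurable A ->
    distribution P (T e) A = exponential_prob 1 A.

Definition graph_at (n : nat) (T : edge n -> {RV P >-> R}) (t : R)
    (w : Omega) : rel 'I_n :=
  fun u v => [exists e : edge n, (val e == [set u; v]%SET) && (T e w <= t)].

Definition ES (n k : nat) (T : edge n -> {RV P >-> R}) (t : R) : \bar R :=
  'E_P[fun w => (S_ k (graph_at T t w))%:R]%E.

End Process.

(* "E S_k(t) = rhs n t (O(bound n t)), uniformly in n >= 1 and 0 <= t < 1/n":
   the O-term is a number eps with |eps| <= K * bound n t, where K depends
   neither on n, nor on t, nor on the probability space carrying the process. *)
Definition ES_expansion (R : realType) (k : nat) (rhs : nat -> R -> R -> R)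
    (bound : nat -> R -> R) : Prop :=
  exists K : R, forall (n : nat) (t : R), (1 <= n)%N -> 0 <= t -> t < n%:R^-1 ->
  forall (d : measure_display) (Omega : measurableType d)
    (P : probability Omega R) (T : edge n -> {RV P >-> R}), is_edge_times T ->
  exists eps : R, `|eps| <= K * bound n t /\ ES k T t = (rhs n t eps)%:E.

(* In the two recursions only the q k with k >= 3, resp. the p k with k >= 2,
   are constrained. *)
Definition q_recursion (R : realType) (q : nat -> {poly R}) : Prop :=
  forall k, (3 <= k)%N ->
    (q k).[1] = 1 /\
    forall x : R, (q k)^`().[x] =
      2^-1 * \sum_(2 <= l < (k - 2).+1)
               'C(k, l)%:R * (q l.+1).[x] * (q (k - l).+1).[x].

Definition p_recursion (R : realType) (p : nat -> {poly R}) : Prop :=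
  forall k, (2 <= k)%N ->
    (p k).[1] = 1 /\
    forall x : R, x != 0 -> (p k)^`().[x] =
      (2 * x ^+ 2)^-1 * \sum_(1 <= l < k)
                          'C(k, l)%:R * (p l.+1).[x] * (p (k - l).+1).[x].

(* Main.v *)
(** Write [F_k(t) = E S_k(t)]. An edge is added between two different components
    [A], [B] at rate [|A||B|] and then increases [S_k] by
    [(|A| + |B|)^k - |A|^k - |B|^k]; hence [F_k'] is
    [1/2 sum_(0 < l < k) 'C(k, l) E D_(l+1, k-l+1)], where [D_(a, b)] is the sum
    of [|A|^a |B|^b] over the ordered pairs of different components. Since
    [D_(a, b) = S_a S_b - S_(a+b)], Harris' inequality gives
    [E D_(a, b) >= F_a F_b - F_(a+b)]; conditioning on the component of a vertex
    gives [E D_(a, b) <= F_a F_b].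

    The functions [P_k = n p_k(1/(1 - n t))] solve the system
    [P_k' = 1/2 sum_l 'C(k, l) P_(l+1) P_(k-l+1)] with the same initial values,
    so a comparison argument (with integrating factor [(1 - n t)^k]) first yields
    [F_k <= P_k = O(n / (1 - n t)^(2k-3))]; in particular the perturbation
    [F_(k+2)] is at most of order [n / (1 - n t)^(2k+1)], and a second comparison
    gives [P_k - F_k = O(n t / (1 - n t)^(2k))]. *)

Require Import Defs.
From mathcomp Require Import all_boot all_order all_algebra.
From mathcomp Require Import all_classical all_reals all_analysis.
From mathcomp Require Import ring lra zify.
From mathcomp Require Import measurable_realfun.
Import Order.TTheory GRing.Theory Num.Theory.
Import numFieldNormedType.Exports.
Set Implicit Arguments.
Unset Strict Implicit.
Unset Printing Implicit Defensive.
Local Open Scope ring_scope.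

(** * Product measure on sets of edges *)

Section ProductMeasure.
Context (R : realDomainType) (E : finType) (p : R).
Implicit Types (H K A : {set E}) (F G : {set E} -> R).

(** The law of a random subset containing each element independently with probability [p], kept as a
    finite sum; measure theory enters only in [ES_mean]. *)
Definition weight H : R := p ^+ #|H| * (1 - p) ^+ #|~: H|%SET.

Definition mean F : R := \sum_H weight H * F H.

Lemma weight_prod H : weight H = \prod_e (if e \in H then p else 1 - p).
Proof.
rewrite /weight (bigID (mem H)) /= -!prodr_const; congr (_ * _).
  by apply: eq_bigr => e ->.
by apply: eq_big => e; rewrite ?inE //; move=> /negbTE ->.
Qed.

Lemma sum_weight : \sum_H weight H = 1.
Proof.
under eq_bigr => H _ do rewrite weight_prod.
rewrite -(bigA_distr _ _ (fun=> p) (fun=> 1 - p)) /=.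
by rewrite big1 // => e _; rewrite subrKC.
Qed.

Lemma eq_mean F G : F =1 G -> mean F = mean G.
Proof. by move=> FG; apply: eq_bigr => H _; rewrite FG. Qed.

Lemma mean_cst c : mean (fun=> c) = c.
Proof. by rewrite /mean -mulr_suml sum_weight mul1r. Qed.

Lemma meanZ c F : mean (fun H => c * F H) = c * mean F.
Proof. by rewrite mulr_sumr; apply: eq_bigr => H _; rewrite mulrCA. Qed.

Lemma mean_sum (I : Type) (r : seq I) (Q : pred I) (F : I -> {set E} -> R) :
  mean (fun H => \sum_(i <- r | Q i) F i H) = \sum_(i <- r | Q i) mean (F i).
Proof.
by rewrite exchange_big; apply: eq_bigr => H _; rewrite mulr_sumr.
Qed.

Lemma meanB F G : mean (fun H => F H - G H) = mean F - mean G.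
Proof. by rewrite -sumrB; apply: eq_bigr => H _; rewrite mulrBr. Qed.

Hypotheses (p_ge0 : 0 <= p) (p_le1 : p <= 1).

Lemma weight_ge0 H : 0 <= weight H.
Proof. by rewrite mulr_ge0 ?exprn_ge0 ?subr_ge0. Qed.

Lemma le_mean F G : (forall H, F H <= G H) -> mean F <= mean G.
Proof. by move=> FG; apply: ler_sum => H _; rewrite ler_wpM2l ?weight_ge0. Qed.

Definition mix A H K := ((H :&: A) :|: (K :\: A))%SET.

Lemma in_mix A H K e : (e \in mix A H K) = (if e \in A then e \in H else e \in K).
Proof. by rewrite !inE; case: (e \in A); rewrite ?andbT ?andbF ?orbF. Qed.

Lemma mixK A H K : mix A (mix A H K) (mix A K H) = H.
Proof. by apply/setP => e; rewrite !in_mix; case: (e \in A). Qed.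

(** The expectation of a function of two independent random subsets. *)
Definition mean2 (G : {set E} -> {set E} -> R) :=
  \sum_H \sum_K weight H * weight K * G H K.

Lemma mean2_mul F G : mean2 (fun H K => F H * G K) = mean F * mean G.
Proof.
rewrite mulr_suml; apply: eq_bigr => H _; rewrite mulr_sumr.
by apply: eq_bigr => K _; ring.
Qed.

Lemma mean2_fst F : mean2 (fun H _ => F H) = mean F.
Proof.
rewrite -[RHS]mulr1 -(mean_cst 1) -mean2_mul.
by apply: eq_bigr => H _; apply: eq_bigr => K _; rewrite mulr1.
Qed.

(* Exchanging the coordinates outside A of two independent copies preserves
   their joint law. *)
Lemma mean2_mix A (G : {set E} -> {set E} -> R) :
  mean2 G = mean2 (fun H K => G (mix A H K) (mix A K H)).
Proof.
rewrite /mean2 !pair_bigA /=.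
have inv : involutive (fun HK : {set E} * {set E} =>
  (mix A HK.1 HK.2, mix A HK.2 HK.1)) by case=> H K /=; rewrite !mixK.
rewrite (reindex_inj (inv_inj inv)); apply: eq_bigr => -[H K] _ /=.
congr (_ * _); rewrite !weight_prod -!big_split; apply: eq_bigr => e _ /=.
by rewrite !in_mix; case: (e \in A); rewrite // mulrC.
Qed.

(** Replacing the coordinates of [H] outside [A] by those of an independent copy [K] leaves [F H]
    unchanged and turns [G H] into [G K]. *)
Lemma mean_indep A F G :
  (forall H K, {in A, H =i K} -> F H = F K) ->
  (forall H K, {in ~: A, H =i K}%SET -> G H = G K) ->
  mean (fun H => F H * G H) = mean F * mean G.
Proof.
move=> FA GA; rewrite -mean2_mul -mean2_fst (mean2_mix A).
apply: eq_bigr => H _; apply: eq_bigr => K _; congr (_ * (_ * _)).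
  by apply: FA => e eA; rewrite in_mix eA.
by apply: GA => e; rewrite inE in_mix => /negbTE ->.
Qed.

(* Harris' inequality, by changing the coordinates in which G reads the
   second copy one at a time: each change decreases the mean. *)
Lemma harris F G :
  {homo F : H K / H \subset K >-> H <= K} ->
  {homo G : H K / H \subset K >-> H <= K} ->
  mean F * mean G <= mean (fun H => F H * G H).
Proof.
(* In [C A] the function [G] reads the first copy on [A] and the second elsewhere, so [C] leads from
   the product of the means to the mean of the product as [A] grows. *)
move=> Fle Gle; pose C A := mean2 (fun H K => F H * G (mix A H K)).
have C0 : C finset.set0 = mean F * mean G.
  rewrite -mean2_mul; apply: eq_bigr => H _; apply: eq_bigr => K _.
  by congr (_ * (_ * G _)); apply/setP => e; rewrite in_mix inE.
have CT : C finset.setT = mean (fun H => F H * G H).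
  rewrite -mean2_fst; apply: eq_bigr => H _; apply: eq_bigr => K _.
  by congr (_ * (_ * G _)); apply/setP => e; rewrite in_mix inE.
suff CA n : (n <= #|E|)%N -> exists2 A : {set E}, #|A| = n & C finset.set0 <= C A.
  have [A cA] := CA _ (leqnn _).
  have -> : A = finset.setT.
    by apply/eqP; rewrite eqEcard finset.subsetT cardsT cA leqnn.
  by rewrite -C0 -CT.
elim: n => [_|n IH nE]; first by exists finset.set0; rewrite ?cards0.
have [A cA leA] := IH (ltnW nE).
have [e eA] : exists e, e \notin A.
  apply/existsP; rewrite -negb_forall; apply: contraL nE => /forallP AT.
  by rewrite -cA -leqNgt; apply: subset_leq_card; apply/fintype.subsetP => e _; exact: AT.
exists (e |: A)%SET; first by rewrite cardsU1 eA cA.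
apply: le_trans leA _; rewrite -subr_ge0.
pose h H K := mix (~: [set e])%SET H K.
have E1 : C (e |: A)%SET - C A = mean2 (fun H K =>
    F H * (G (mix (e |: A) H K) - G (mix A H K))).
  rewrite /C /mean2 -sumrB; apply: eq_bigr => H _; rewrite -sumrB.
  by apply: eq_bigr => K _; ring.
(* Swapping the coordinate [e] of the two copies exchanges the two values of [G]; adding this to
   [E1] gives an integrand that is a difference of values of [F] times one of [G]. *)
have E2 : C (e |: A)%SET - C A = mean2 (fun H K =>
    F (h H K) * (G (mix A H K) - G (mix (e |: A) H K))).
  rewrite E1 (mean2_mix (~: [set e])%SET).
  apply: eq_bigr => H _; apply: eq_bigr => K _; congr (_ * (_ * (G _ - G _)));
    apply/setP => f; rewrite !in_mix !inE; case: eqP => //= -> ; rewrite ?(negbTE eA) //.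
rewrite -(pmulrn_lge0 _ (ltn0Sn 1)) mulr2n {1}E1 E2 /mean2 -big_split.
apply: sumr_ge0 => H _; rewrite -big_split; apply: sumr_ge0 => K _ /=.
rewrite -mulrDr; apply: mulr_ge0; first by rewrite mulr_ge0 ?weight_ge0.
have -> (a b c d : R) : a * (b - c) + d * (c - b) = (a - d) * (b - c) by ring.
(* Both factors compare sets that differ at most in [e], and whether [e] lies in [H] fixes their
   common sign. *)
have [eH|eH] := boolP (e \in H).
  by apply: mulr_ge0; rewrite subr_ge0; [apply: Fle|apply: Gle];
    apply/fintype.subsetP => f; rewrite !in_mix !inE; case: eqP => //= ->;
    rewrite ?eH ?(negbTE eA).
by apply: mulr_le0; rewrite subr_le0; [apply: Fle|apply: Gle];
    apply/fintype.subsetP => f; rewrite !in_mix !inE; case: eqP => //= ->;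
    rewrite ?(negbTE eH) ?(negbTE eA).
Qed.

End ProductMeasure.

(** * Component sizes *)

Lemma eq_set2 (T : finType) (x y u v : T) :
  ([set x; y]%SET == [set u; v]%SET) =
  ((x == u) && (y == v)) || ((x == v) && (y == u)).
Proof.
apply/eqP/orP => [E|[/andP[/eqP-> /eqP->]|/andP[/eqP-> /eqP->]]] //; last first.
  exact: finset.setUC.
have /set2P xuv : x \in [set u; v]%SET by rewrite -E set21.
have /set2P yuv : y \in [set u; v]%SET by rewrite -E set22.
have /set2P uxy : u \in [set x; y]%SET by rewrite E set21.
have /set2P vxy : v \in [set x; y]%SET by rewrite E set22.
case: xuv yuv uxy vxy => -> [] -> [] // ? [] // ?; subst; rewrite ?eqxx; by [left|right].
Qed.

Section EdgeSets.
Context (R : realFieldType) (n : nat).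
Implicit Types (H K : {set edge n}) (A B : {set 'I_n}) (u v x y : 'I_n).

Definition gr H : rel 'I_n :=
  fun u v => [exists e : edge n, (val e == [set u; v]%SET) && (e \in H)].

Definition ccomp H u : {set 'I_n} := [set v | connect (gr H) u v]%SET.

Lemma gr_connect_sym H : connect_sym (gr H).
Proof.
apply: sym_connect_sym => u v.
by apply: eq_existsb => e; rewrite finset.setUC.
Qed.

Lemma ccomp_refl H u : u \in ccomp H u.
Proof. by rewrite inE. Qed.

Lemma ccomp_sym H u v : (v \in ccomp H u) = (u \in ccomp H v).
Proof. by rewrite !inE gr_connect_sym. Qed.

Lemma ccomp_eq H u v : v \in ccomp H u -> ccomp H v = ccomp H u.
Proof.
rewrite inE => uv; apply/setP => w; rewrite !inE.
by rewrite (same_connect (gr_connect_sym H) uv).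
Qed.

Lemma ccomp_gr H u x y : x \in ccomp H u -> gr H x y -> y \in ccomp H u.
Proof. by rewrite !inE => ux xy; apply: connect_trans ux (connect1 xy). Qed.

Lemma ccomp_sub H u B :
  u \in B -> (forall x y, x \in B -> gr H x y -> y \in B) ->
  ccomp H u \subset B.
Proof.
move=> uB HB; apply/fintype.subsetP => v; rewrite inE => /connectP[p].
elim: p u uB => [|x p IH] u uB /=; first by move=> _ ->.
by case/andP => /(HB _ _ uB); exact: IH.
Qed.

Lemma gr_sub H K u v : H \subset K -> gr H u v -> gr K u v.
Proof.
move=> HK /existsP[e /andP[euv eH]]; apply/existsP; exists e.
by rewrite euv (fintype.subsetP HK).
Qed.

Lemma ccomp_mono H K u : H \subset K -> ccomp H u \subset ccomp K u.
Proof.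
move=> HK; apply: ccomp_sub (ccomp_refl _ _) _ => x y ux xy.
exact: ccomp_gr ux (gr_sub HK xy).
Qed.

Definition csize H u : R := #|ccomp H u|%:R.

(** A component of size c holds c vertices, so this vertex sum is S_(j+1), see [S_gr]; likewise
    [cpow2 i j] is the pair sum D_(i+1, j+1). *)
Definition cpow (j : nat) H : R := \sum_u csize H u ^+ j.

Definition cpow2 (i j : nat) H : R :=
  \sum_u \sum_(v | v \notin ccomp H u) csize H u ^+ i * csize H v ^+ j.

Lemma csize_ge0 H u : 0 <= csize H u.
Proof. exact: ler0n. Qed.

Lemma csize_ge1 H u : 1 <= csize H u.
Proof. by rewrite ler1n card_gt0; apply/set0Pn; exists u; exact: ccomp_refl. Qed.

Lemma le_csize H K u : H \subset K -> csize H u <= csize K u.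
Proof. by move=> HK; rewrite ler_nat subset_leq_card// ccomp_mono. Qed.

Lemma le_cpow j H K : H \subset K -> cpow j H <= cpow j K.
Proof.
by move=> HK; apply: ler_sum => u _; rewrite lerXn2r ?nnegrE ?csize_ge0 ?le_csize.
Qed.

Lemma csize_eq H u v : v \in ccomp H u -> csize H v = csize H u.
Proof. by rewrite /csize => /ccomp_eq ->. Qed.

Lemma sum_comp_csize H u j :
  \sum_(v in ccomp H u) csize H v ^+ j = csize H u ^+ j.+1.
Proof.
rewrite (eq_bigr (fun=> csize H u ^+ j)); last by move=> v /csize_eq ->.
by rewrite sumr_const exprS mulr_natl.
Qed.

Lemma S_gr k H : (S_ k.+1 (gr H))%:R = cpow k H.
Proof.
have eqR : {in [set: 'I_n]%SET & &, equivalence_rel (connect (gr H))}.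
  move=> x y z _ _ _; split => // xy.
  exact: same_connect (gr_connect_sym H) _ _ xy z.
have /and3P[_ tI _] := equivalence_partitionP eqR.
rewrite /S_ natr_sum /cpow.
transitivity (\sum_(u in [set: 'I_n]%SET) csize H u ^+ k); last first.
  by apply: eq_bigl => u; rewrite inE.
rewrite (set_partition_big _ (equivalence_partitionP eqR)) /=.
apply: eq_bigr => C /imsetP[u _ ->].
have -> : [set y in [set: 'I_n] | connect (gr H) u y]%SET = ccomp H u.
  by apply/setP => v; rewrite !inE.
by rewrite sum_comp_csize natrX.
Qed.

(** For fixed [u], the vertices [v] in its own component contribute [csize H u] to the power i + j +
    1, which is what is subtracted. *)
Lemma cpow2E i j H : cpow2 i j H = cpow i H * cpow j H - cpow (i + j).+1 H.
Proof.
rewrite mulr_suml -sumrB; apply: eq_bigr => u _.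
rewrite [cpow j H](bigID (mem (ccomp H u))) /= sum_comp_csize mulrDr -mulr_sumr.
by rewrite -exprD addnS addrAC subrr add0r.
Qed.

Lemma gr_add e H u v x y : val e = [set u; v]%SET ->
  gr (e |: H)%SET x y = [|| gr H x y, (x == u) && (y == v) | (x == v) && (y == u)].
Proof.
move=> euv; apply/existsP/idP => [[f]|].
  rewrite !inE => /andP[fxy /orP[/eqP fe|fH]]; last first.
    by apply/orP; left; apply/existsP; exists f; rewrite fxy.
  apply/orP; right; move: fxy; rewrite fe euv eq_sym eq_set2.
  by case/orP => /andP[-> ->]; rewrite ?orbT.
case/or3P => [/existsP[f /andP[fxy fH]]|/andP[/eqP-> /eqP->]|/andP[/eqP-> /eqP->]].
- by exists f; rewrite fxy inE fH orbT.
- by exists e; rewrite euv eqxx !inE eqxx.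
- by exists e; rewrite euv finset.setUC eqxx !inE eqxx.
Qed.

(** The right-hand side contains [x] and is closed under the edges of the enlarged graph; the other
    inclusion is monotonicity. *)
Lemma ccomp_add e H u v x : val e = [set u; v]%SET ->
  ccomp (e |: H)%SET x = if x \in (ccomp H u :|: ccomp H v)%SET
                        then (ccomp H u :|: ccomp H v)%SET else ccomp H x.
Proof.
move=> euv; have sub y : ccomp H y \subset ccomp (e |: H)%SET y.
  by apply: ccomp_mono; rewrite finset.subsetUr.
have uv : ccomp (e |: H)%SET v = ccomp (e |: H)%SET u.
  apply: ccomp_eq; apply: ccomp_gr (ccomp_refl _ _) _.
  by rewrite (gr_add _ _ _ euv) !eqxx orbT.
apply/eqP; rewrite finset.eqEsubset; apply/andP; split; last first.
  case: ifP => // xuv; have -> : ccomp (e |: H)%SET x = ccomp (e |: H)%SET u.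
    apply: ccomp_eq; move: xuv; rewrite finset.in_setU => /orP[] xu.
      exact: (fintype.subsetP (sub u)).
    by rewrite -uv; exact: (fintype.subsetP (sub v)).
  by rewrite finset.subUset sub -uv sub.
apply: ccomp_sub => [|y z].
  by case: ifP => // _; rewrite ccomp_refl.
case: ifPn => xuv.
  rewrite !(finset.in_setU) (gr_add _ _ _ euv) => /orP yuv /or3P[yz|/andP[_ /eqP->]|/andP[_ /eqP->]];
    rewrite ?ccomp_refl ?orbT //.
  by case: yuv => yu; rewrite (ccomp_gr yu yz) ?orbT.
rewrite (gr_add _ _ _ euv) => xy /or3P[yz|/andP[/eqP yu _]|/andP[/eqP yv _]].
- exact: ccomp_gr xy yz.
- by move: xuv; rewrite finset.in_setU (ccomp_sym H u) -yu xy.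
- by move: xuv; rewrite finset.in_setU (ccomp_sym H v) -yv xy orbT.
Qed.

(** Merging components of sizes a and b changes the sum by (a + b)^(k+1) - a^(k+1) - b^(k+1), so the
    binomial expansion loses its two extreme terms. *)
Lemma cpow_add k e H u v : val e = [set u; v]%SET ->
  cpow k (e |: H)%SET - cpow k H =
  if v \in ccomp H u then 0 else
  \sum_(1 <= l < k.+1) 'C(k.+1, l)%:R * (csize H u ^+ l * csize H v ^+ (k.+1 - l)).
Proof.
move=> euv; case: ifPn => vu.
  rewrite -sumrB big1 // => x _; rewrite /csize (ccomp_add _ _ euv).
  rewrite (ccomp_eq vu) finset.setUid; case: ifP => [/ccomp_eq ->|_]; exact: subrr.
have dis : [disjoint ccomp H u & ccomp H v].
  rewrite -setI_eq0; apply/eqP/setP => x; rewrite finset.in_setI finset.in_set0.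
  apply/negP => /andP[/ccomp_eq xu /ccomp_eq xv].
  by move: vu; rewrite -xu xv ccomp_refl.
have cUE : #|ccomp H u :|: ccomp H v|%SET%:R = csize H u + csize H v.
  by rewrite cardsU disjoint_setI0 // cards0 subn0 natrD.
rewrite -sumrB (bigID (mem (ccomp H u :|: ccomp H v)%SET)) /=.
rewrite [X in _ + X]big1 ?addr0; last first.
  by move=> x /negbTE xuv; rewrite /csize (ccomp_add _ _ euv) xuv subrr.
rewrite (eq_bigr (fun x => (csize H u + csize H v) ^+ k - csize H x ^+ k)); last first.
  by move=> x xuv; rewrite {1}/csize (ccomp_add _ _ euv) xuv cUE.
rewrite sumrB sumr_const -mulr_natl cUE -exprS.
rewrite (eq_bigl [predU ccomp H u & ccomp H v]); last by move=> x; rewrite !inE.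
rewrite bigU //= !sum_comp_csize.
rewrite [csize H u + _]addrC exprDn -(big_mkord xpredT (fun i =>
  csize H v ^+ (k.+1 - i) * csize H u ^+ i *+ 'C(k.+1, i))).
rewrite big_ltn // big_nat_recr //= subn0 subnn !expr0 bin0 binn !mulr1n mulr1 mul1r.
rewrite (_ : forall a b c : R, a + (b + c) - (c + a) = b) //; last by move=> *; ring.
by apply: eq_bigr => i _; rewrite mulr_natl mulrC.
Qed.

(** Each edge comes from exactly two ordered pairs of distinct vertices, whence the factor 1/2. *)
Lemma sum_edge (X : edge n -> R) (Y : 'I_n -> 'I_n -> R) :
  (forall u, Y u u = 0) ->
  (forall e u v, val e = [set u; v]%SET -> X e = Y u v) ->
  \sum_e X e = 2^-1 * \sum_u \sum_v Y u v.
Proof.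
move=> Y0 XY.
rewrite pair_bigA /= (bigID (fun uv : 'I_n * 'I_n => uv.1 == uv.2)) /=.
rewrite [X in X + _]big1 ?add0r; last by case=> u v /= /eqP ->.
have inj (u v : 'I_n) : u != v -> #|[set u; v]%SET| == 2%N by rewrite cards2 => ->.
pose f (uv : 'I_n * 'I_n) : option (edge n) := insub [set uv.1; uv.2]%SET.
rewrite (partition_big f (fun o => o != None)) /=; last first.
  by move=> [u v] /= /inj uv; rewrite /f insubT.
rewrite (reindex_omap (@Some (edge n)) id) /=; last by case.
rewrite mulr_sumr; apply: eq_big => [e|e _]; first by rewrite eqxx.
have /cards2P[u [v [uv euv]]] := valP e.
have E (w : 'I_n * 'I_n) : (w.1 != w.2) && (f w == Some e) = (w \in [:: (u, v); (v, u)]).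
  case: w => x y; rewrite !inE !xpair_eqE -eq_set2 -euv /=.
  have [<-|xy] /= := eqVneq x y.
    by apply/esym/eqP => exx; have := valP e; rewrite /= -exx cards2 eqxx.
  rewrite /f; case: insubP => [e' _ /= <-|]; last by rewrite inj.
  by apply/eqP/eqP => [[->]|/val_inj ->].
rewrite (eq_bigl _ _ E) -big_uniq /=; last by rewrite inE xpair_eqE (negbTE uv).
rewrite big_cons big_seq1 /= -(XY _ _ _ euv) -(XY e v u); last by rewrite finset.setUC.
by field.
Qed.

(** The generator of the process applied to S_(k+1). Edges inside a component, in particular those
    already in [H], contribute 0. *)
Lemma sum_cpow_add k H :
  \sum_(e : edge n) (cpow k (e |: H)%SET - cpow k H) =
  2^-1 * \sum_(1 <= l < k.+1) 'C(k.+1, l)%:R * cpow2 l (k.+1 - l) H.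
Proof.
pose Y u v := if v \in ccomp H u then 0 else
  \sum_(1 <= l < k.+1) 'C(k.+1, l)%:R * (csize H u ^+ l * csize H v ^+ (k.+1 - l)).
rewrite (@sum_edge _ Y); last 2 first.
- by move=> u; rewrite /Y ccomp_refl.
- by move=> e u v euv; rewrite (cpow_add _ _ euv).
congr (_ * _); under [RHS]eq_bigr => l _ do rewrite mulr_sumr.
rewrite [RHS]exchange_big /=; apply: eq_bigr => u _.
under [RHS]eq_bigr => l _ do rewrite mulr_sumr.
rewrite [RHS]exchange_big /= [RHS]big_mkcond; apply: eq_bigr => v _.
by rewrite /Y; case: ifP.
Qed.

Context (p : R) (p_ge0 : 0 <= p) (p_le1 : p <= 1).

(* On the event that A is the component of u, the component of a vertex v
   outside A is determined by the edges inside ~: A, and the event itself by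
   the remaining edges. *)
Lemma mean_comp_le A u v j :
  mean p (fun H => (ccomp H u == A)%:R * ((v \notin ccomp H u)%:R * csize H v ^+ j))
  <= mean p (fun H => (ccomp H u == A)%:R) * mean p (fun H => csize H v ^+ j).
Proof.
(* [E] consists of the edges meeting [A], and [G] measures the component of [v] by means of the
   other edges only. *)
pose E := [set e : edge n | ~~ (val e \subset ~: A)]%SET.
pose G H : R := csize (H :\: E)%SET v ^+ j.
have mono H : G H <= csize H v ^+ j.
  by rewrite lerXn2r ?nnegrE ?csize_ge0 // le_csize // finset.subsetDl.
have grE H K x y : {in E, H =i K} -> x \in A -> gr H x y -> gr K x y.
  move=> HK xA /existsP[e /andP[exy eH]]; apply/existsP; exists e.
  rewrite exy -HK // inE (eqP exy); apply/negP => /fintype.subsetP/(_ x).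
  by rewrite !inE eqxx xA => /(_ isT).
(* Exploring the component of [u] inspects only edges meeting [A] as long as it stays in [A]; hence
   [E] determines the event. *)
have compA H K : {in E, H =i K} -> ccomp H u = A -> ccomp K u = A.
  move=> HK HuA.
  have uA : u \in A by rewrite -HuA ccomp_refl.
  apply/eqP; rewrite finset.eqEsubset; apply/andP; split.
    apply: ccomp_sub => // x y xA xy; rewrite -HuA; apply: (@ccomp_gr _ _ x).
      by rewrite HuA.
    by apply: grE xy => // e eE; rewrite HK.
  suff : ccomp H u \subset (A :&: ccomp K u)%SET by rewrite HuA finset.subsetI => /andP[].
  apply: ccomp_sub => [|x y]; first by rewrite finset.in_setI uA ccomp_refl.
  rewrite !finset.in_setI => /andP[xA xu] xy; apply/andP; split.
    by rewrite -HuA; apply: ccomp_gr xy; rewrite HuA.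
  by apply: ccomp_gr xu _; apply: grE xy.
apply: (@le_trans _ _ (mean p (fun H => (ccomp H u == A)%:R * G H))).
  apply: le_mean => // H; case: eqP => [HuA|_]; last by rewrite !mul0r.
  rewrite !mul1r HuA; case: (boolP (v \in A)) => vA /=.
    by rewrite mul0r exprn_ge0 ?csize_ge0.
  rewrite mul1r /G.
  rewrite lerXn2r ?nnegrE ?csize_ge0 // ler_nat subset_leq_card //.
  (* On the event no edge leaves [A], so the component of [v] avoids [A] and uses no edge of [E]. *)
  suff : ccomp H v \subset (ccomp (H :\: E)%SET v :\: A)%SET.
    by move=> vsub; apply: fintype.subset_trans vsub (finset.subsetDl _ _).
  apply: ccomp_sub => [|x y]; first by rewrite finset.in_setD ccomp_refl vA.
  rewrite !finset.in_setD => /andP[xA xv] xy.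
  have yA : y \notin A.
    apply: contra xA; rewrite -HuA => yu; apply: ccomp_gr yu _.
    by move: xy; rewrite /gr finset.setUC.
  rewrite yA; apply: ccomp_gr xv _; case/existsP: xy => e /andP[exy eH].
  apply/existsP; exists e; rewrite exy finset.in_setD eH andbT inE negbK (eqP exy).
  by apply/fintype.subsetP => z; rewrite !inE => /orP[]/eqP->.
rewrite (@mean_indep _ _ _ E).
- by rewrite ler_wpM2l ?le_mean // -(mean_cst (edge n) p 0) le_mean.
- move=> H K HK; congr (nat_of_bool _)%:R; apply/eqP/eqP; apply: compA => //.
  by move=> e eE; rewrite HK.
- move=> H K HK; rewrite /G; congr (csize _ _ ^+ _); apply/setP => e.
  by rewrite !finset.in_setD; case: (boolP (e \in E)) => //= eE; rewrite HK // inE.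
Qed.

Lemma mean_cpow2_le i j :
  mean p (cpow2 i j) <= mean p (cpow i) * mean p (cpow j).
Proof.
(* Decomposition according to the value [A] of the component of [u], whose size is then a
   constant. *)
have split_comp (f : {set edge n} -> R) u i' H : csize H u ^+ i' * f H =
    \sum_(A : {set 'I_n}) #|A|%:R ^+ i' * ((ccomp H u == A)%:R * f H).
  rewrite (bigD1 (ccomp H u)) //= eqxx mul1r big1 ?addr0 // => A.
  by rewrite eq_sym => /negbTE ->; rewrite mul0r mulr0.
rewrite /cpow2 mean_sum [mean p (cpow i)]mean_sum mulr_suml.
apply: ler_sum => u _.
rewrite (_ : mean _ _ = \sum_v mean p (fun H => csize H u ^+ i *
    ((v \notin ccomp H u)%:R * csize H v ^+ j))); last first.
  rewrite -mean_sum; apply: eq_mean => H; rewrite big_mkcond; apply: eq_bigr => v _.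
  by case: ifP; rewrite ?mul1r // mul0r mulr0.
rewrite [mean p (cpow j)]mean_sum mulr_sumr; apply: ler_sum => v _.
under eq_mean => H do
  rewrite (split_comp (fun H => (v \notin ccomp H u)%:R * csize H v ^+ j)).
have -> : mean p (fun H => csize H u ^+ i) =
    \sum_(A : {set 'I_n}) #|A|%:R ^+ i * mean p (fun H => (ccomp H u == A)%:R).
  under eq_bigr => A _ do rewrite -meanZ.
  rewrite -mean_sum; apply: eq_mean => H; rewrite -[LHS]mulr1 (split_comp (fun=> 1)).
  by apply: eq_bigr => A _; rewrite mulr1.
rewrite mean_sum mulr_suml; apply: ler_sum => A _; rewrite meanZ -mulrA.
by rewrite ler_wpM2l ?exprn_ge0 // mean_comp_le.
Qed.

(** Power sums of component sizes increase when edges are added, so Harris' inequality makes them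
    positively correlated. *)
Lemma mean_cpow2_ge i j :
  mean p (cpow i) * mean p (cpow j) - mean p (cpow (i + j).+1)
  <= mean p (cpow2 i j).
Proof.
under [leRHS]eq_mean => H do rewrite cpow2E.
by rewrite meanB lerD2r harris // => H K; exact: le_cpow.
Qed.

End EdgeSets.

(** * The law of the process at time t *)

Section EdgeTimes.
Context (R : realType) (d : measure_display) (Omega : measurableType d).
Context (P : probability Omega R).

Lemma exponential_prob_le (t : R) : 0 <= t ->
  exponential_prob 1 `]-oo, t]%classic = (1 - expR (- t))%:E.
Proof.
move=> t0; rewrite /exponential_prob.
have -> : (`]-oo, t] = `]-oo, 0[ `|` `[0, t])%classic.
  by rewrite -itv_bndbnd_setU // bnd_simp.
rewrite ge0_integral_setU //=; last 3 first.
- apply/measurable_EFinP; apply: measurable_funTS.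
  exact: measurable_exponential_pdf.
- by move=> x _; rewrite lee_fin exponential_pdf_ge0.
- apply/disj_set2P/seteqP; split => // x [] /=.
  by rewrite !in_itv /= => x0; rewrite leNgt x0.
rewrite integral0_eq ?add0e; last first.
  by move=> x /=; rewrite in_itv /= => x0; rewrite lt0_exponential_pdf.
move: t0; rewrite le_eqVlt => /predU1P[<-|t0].
  by rewrite set_itv1 integral_set1 oppr0 expR0 subrr.
by have := @exponential_prob_itv0c R 1 t t0; rewrite /exponential_prob mulN1r EFinB.
Qed.

(** By independence, the edges present at time [t] form a random subset with law [weight] for p = 1
    - exp(-t). *)
Lemma ES_mean (n k : nat) (T : edge n -> {RV P >-> R}) (t : R) :
  is_edge_times T -> 0 <= t ->
  ES k.+1 T t = (mean (1 - expR (- t)) (@cpow R n k))%:E.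
Proof.
move=> [indT lawT] t0; set p := 1 - expR (- t).
pose A (H : {set edge n}) e : set R := if e \in H then `]-oo, t]%classic else `]t, +oo[%classic.
have mA H e : measurable (A H e) by rewrite /A; case: ifP.
(* The event that exactly the edges of [H] have arrived by time [t]. These events partition the
   probability space, so [S_] is a finite combination of their indicators. *)
pose V (H : {set edge n}) := [set w | forall e, e \in finset.setT -> A H e (T e w)]%classic.
have PA H e : P (T e @^-1` A H e)%classic = (if e \in H then p else 1 - p)%:E.
  have := lawT e; rewrite /distribution /pushforward => lawTe.
  have le : P (T e @^-1` `]-oo, t])%classic = p%:E.
    by rewrite lawTe // exponential_prob_le.
  rewrite /A; case: ifP => // _.
  rewrite -setCitvl preimage_setC probability_setC ?le //.
  exact: (measurable_funPTI _ (measurable_itv _)).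
have PV H : P (V H) = (weight p H)%:E.
  rewrite /V indT // weight_prod -prodEFin.
  by apply: eq_big => [e|e _]; rewrite ?inE.
have mV H : measurable (V H).
  have -> : V H = (\bigcap_(e in [set: edge n]) (T e @^-1` A H e))%classic.
    by apply/seteqP; split => w /= Vw e; [move=> _; apply: Vw; rewrite inE|move=> _; exact: Vw].
  apply: fin_bigcap_measurable => // e _.
  by apply: measurable_funPTI; exact: mA.
pose Hw w := [set e | T e w <= t]%SET.
have VH H w : V H w <-> H = Hw w.
  split=> [Vw|-> e _]; last first.
    by rewrite /A inE; case: ifP; rewrite /= in_itv /= ?andbT // ltNge => ->.
  apply/setP => e; have := Vw e (finset.in_setT _); rewrite /A inE.
  by case: (e \in H); rewrite /= in_itv /= ?andbT ?ltNge; [|move/negbTE].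
have SE w : (S_ k.+1 (graph_at T t w))%:R = \sum_H @cpow R n k H * \1_(V H) w :> R.
  have -> : graph_at T t w = gr (Hw w).
    by apply/funext => u; apply/funext => v; apply: eq_existsb => e; rewrite inE.
  rewrite S_gr (bigD1 (Hw w)) //= indicE mem_set ?mulr1; last exact/VH.
  by rewrite big1 ?addr0 // => H /eqP HH; rewrite indicE memNset ?mulr0 // => /VH.
rewrite /ES unlock.
under eq_integral => w _ do rewrite SE -sumEFin.
rewrite ge0_integral_sum //; last 2 first.
- move=> H; apply/measurable_EFinP; apply: measurable_funM => //.
- move=> H w _; rewrite lee_fin mulr_ge0 // /cpow sumr_ge0 // => u _.
  by rewrite exprn_ge0 ?csize_ge0.
rewrite /mean -sumEFin; apply: eq_bigr => H _.
under eq_integral => w _ do rewrite EFinM.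
rewrite ge0_integralZl //; last 2 first.
- exact/measurable_EFinP.
- by rewrite lee_fin /cpow sumr_ge0 // => u _; rewrite exprn_ge0 ?csize_ge0.
rewrite integral_indic // setIT mulrC EFinM; congr (_ * _)%E; exact: PV.
Qed.

End EdgeTimes.

(** * The polynomials p_k and q_k *)

Section Polynomials.
Context (R : realType).
Implicit Types (u v : {poly R}).

(** The constant coefficient is a quotient by 0, hence 0 by convention. *)
Definition antideriv u : {poly R} := \poly_(i < (size u).+1) (u`_i.-1 / i%:R).

Lemma deriv_antideriv u : (antideriv u)^`() = u.
Proof.
apply/polyP => i; rewrite coef_deriv coef_poly ltnS /=.
case: ltnP => ui; last by rewrite mul0rn nth_default.
by rewrite -[LHS]mulr_natr divfK // pnatr_eq0.
Qed.

Lemma horner_inj u v : (forall x : R, x != 0 -> u.[x] = v.[x]) -> u = v.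
Proof.
move=> uv; apply/eqP; rewrite -subr_eq0; apply/negP => /negP D0.
(* These are distinct nonzero roots of the difference, as many as its size and thus too many. *)
pose rs := [seq i.+1%:R : R | i <- iota 0 (size (u - v))].
suff : (size rs < size (u - v)%R)%N by rewrite size_map size_iota ltnn.
apply: max_poly_roots => //.
  apply/allP => x /mapP[i _ ->]; have i0 : i.+1%:R != 0 :> R by rewrite pnatr_eq0.
  by rewrite rootE hornerD hornerN uv ?subrr.
rewrite map_inj_uniq ?iota_uniq // => i j /eqP.
by rewrite eqr_nat eqSS => /eqP.
Qed.

Lemma deriv_inj u v (a : R) : u^`() = v^`() -> u.[a] = v.[a] -> u = v.
Proof.
move=> duv uva; apply/eqP; rewrite -subr_eq0; apply/eqP.
have dD : (u - v)^`() = 0 by rewrite derivB duv subrr.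
have Dc : u - v = ((u - v)`_0)%:P.
  apply/polyP => -[|i]; rewrite coefC //=.
  have /eqP := congr1 (fun w : {poly R} => w`_i) dD.
  by rewrite coef_deriv coef0 mulrn_eq0 /= => /eqP.
have : (u - v).[a] = 0 by rewrite hornerD hornerN uva subrr.
by rewrite Dc hornerC => ->.
Qed.

(** Positivity of the top coefficient excludes cancellation in sums, which is how exact degrees pass
    through the recursion. *)
Definition pos_deg (m : nat) u := (size u <= m.+1)%N /\ 0 < u`_m.

Lemma pos_deg_size m u : pos_deg m u -> size u = m.+1.
Proof.
case=> us u0; apply/eqP; rewrite eqn_leq us ltnNge; apply/negP => ms.
by move: u0; rewrite nth_default // ltxx.
Qed.

Lemma pos_degD m u v : pos_deg m u -> pos_deg m v -> pos_deg m (u + v).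
Proof.
move=> [us u0] [vs v0]; split; last by rewrite coefD addr_gt0.
by rewrite (leq_trans (size_polyD _ _)) // geq_max us.
Qed.

Lemma pos_degZ m u (c : R) : 0 < c -> pos_deg m u -> pos_deg m (c *: u).
Proof.
move=> c0 [us u0]; split; last by rewrite coefZ mulr_gt0.
by rewrite (leq_trans (size_scale_leq _ _)).
Qed.

Lemma pos_degM m1 m2 u v :
  pos_deg m1 u -> pos_deg m2 v -> pos_deg (m1 + m2) (u * v).
Proof.
move=> pu pv; have us := pos_deg_size pu; have vs := pos_deg_size pv.
have u0 : u != 0 by rewrite -size_poly_eq0 us.
have v0 : v != 0 by rewrite -size_poly_eq0 vs.
have uvs : size (u * v) = (m1 + m2).+1 by rewrite size_mul // us vs addSn addnS.
split; first by rewrite uvs.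
have := lead_coefM u v; rewrite !lead_coefE uvs us vs /= => ->.
by rewrite mulr_gt0 ?(proj2 pu) ?(proj2 pv).
Qed.

Lemma pos_deg_sum m (r : seq nat) (F : nat -> {poly R}) :
  r != [::] -> (forall i, i \in r -> pos_deg m (F i)) ->
  pos_deg m (\sum_(i <- r) F i).
Proof.
elim: r => // i [|j r] IH _ Fm.
  by rewrite big_seq1; apply: Fm; rewrite inE.
rewrite big_cons; apply: pos_degD; first by apply: Fm; rewrite inE eqxx.
by apply: IH => // l lr; apply: Fm; rewrite inE lr orbT.
Qed.

Lemma pos_deg_deriv m u : pos_deg m u^`() -> pos_deg m.+1 u.
Proof.
move=> [us u0]; split; last by move: u0; rewrite coef_deriv pmulrn_lgt0.
apply/leq_sizeP => -[//|i] mi.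
have /eqP : u^`()`_i = 0 by rewrite nth_default // (leq_trans us).
by rewrite coef_deriv mulrn_eq0 /= => /eqP.
Qed.

Definition q_rhs (q : nat -> {poly R}) (k : nat) : {poly R} :=
  2^-1 *: \sum_(2 <= l < (k - 2).+1) 'C(k, l)%:R *: (q l.+1 * q (k - l).+1).

(** The recursion at [k] involves only the indices from 3 to k - 1, so fuel [k] suffices, see
    [qfuel_stable]. The added constant enforces the value 1 at 1. *)
Fixpoint qfuel (m k : nat) : {poly R} :=
  if m is m'.+1 then
    let A := antideriv (q_rhs (qfuel m') k) in A + (1 - A.[1])%:P
  else 1.

Definition qpol k := qfuel k k.

Lemma q_rhs_eq (q1 q2 : nat -> {poly R}) k :
  (forall j, (3 <= j < k)%N -> q1 j = q2 j) -> q_rhs q1 k = q_rhs q2 k.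
Proof.
move=> q12; congr (_ *: _); apply: eq_big_nat => l lk.
by rewrite !q12 //; lia.
Qed.

Lemma qfuel_stable m1 m2 k : (0 < k)%N -> (k <= m1)%N -> (k <= m2)%N ->
  qfuel m1 k = qfuel m2 k.
Proof.
elim: m1 m2 k => [|m1 IH] [|m2] k; try lia; move=> k0 k1 k2.
by rewrite /= (@q_rhs_eq _ (qfuel m2)) // => j jk; apply: IH; lia.
Qed.

Lemma qpol_deriv k : (0 < k)%N -> (qpol k)^`() = q_rhs qpol k.
Proof.
case: k => // k _; rewrite /qpol /= derivD derivC addr0 deriv_antideriv.
by apply: q_rhs_eq => j jk; apply: qfuel_stable; lia.
Qed.

Lemma qpol1 k : (qpol k).[1] = 1.
Proof. by case: k => [|k]; rewrite /qpol /= ?hornerD hornerC // subrKC. Qed.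

Lemma horner_q_rhs (q : nat -> {poly R}) k x : (q_rhs q k).[x] =
  2^-1 * \sum_(2 <= l < (k - 2).+1)
           'C(k, l)%:R * (q l.+1).[x] * (q (k - l).+1).[x].
Proof.
rewrite hornerZ horner_sum; congr (_ * _); apply: eq_bigr => l _.
by rewrite hornerZ hornerM mulrA.
Qed.

Lemma q_rhs_small (q : nat -> {poly R}) k : (k <= 3)%N -> q_rhs q k = 0.
Proof. by move=> k3; rewrite /q_rhs big_geq ?scaler0 //; lia. Qed.

Lemma qpol_rec : q_recursion qpol.
Proof.
by move=> k k3; split=> [|x]; rewrite ?qpol1 // qpol_deriv ?horner_q_rhs //; lia.
Qed.

Lemma q_recursion_uniq (q' : nat -> {poly R}) : q_recursion q' ->
  forall k, (3 <= k)%N -> q' k = qpol k.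
Proof.
move=> q'rec k; have [m km] := ubnP k; elim: m k km => // m IH k km k3.
have [q'1 dq'] := q'rec k k3.
apply: (@deriv_inj _ _ 1); last by rewrite q'1 qpol1.
rewrite qpol_deriv; last by lia.
apply: horner_inj => x _; rewrite dq' -horner_q_rhs; congr (_.[x]).
by apply: q_rhs_eq => j jk; apply: IH; lia.
Qed.

Lemma qpol3 : qpol 3 = 1.
Proof.
apply: (@deriv_inj _ _ 1); last by rewrite qpol1 hornerE.
by rewrite qpol_deriv // q_rhs_small // derivC.
Qed.

Lemma qpol4 : qpol 4 = 3 *: 'X - 2%:P.
Proof.
apply: (@deriv_inj _ _ 1); last by rewrite qpol1 !hornerE; ring.
rewrite qpol_deriv // /q_rhs big_nat1 /= qpol3 mulr1.
rewrite derivB derivZ derivX derivC subr0 scalerA; congr (_ *: _).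
have -> : 'C(4, 2) = 6%N by [].
by field.
Qed.

Lemma qpol_pos_deg k : (3 <= k)%N -> pos_deg (k - 3) (qpol k).
Proof.
have [m km] := ubnP k; elim: m k km => // m IH k km k3.
have [k4|k4] := leqP k 3.
  have -> : k = 3%N by lia.
  by rewrite qpol3 subnn; split; rewrite ?size_poly1 // coef1.
have -> : (k - 3 = (k - 4).+1)%N by lia.
apply: pos_deg_deriv; rewrite qpol_deriv; last by lia.
apply: pos_degZ; first by rewrite invr_gt0 ltr0n.
apply: pos_deg_sum => [|l].
  by rewrite -size_eq0 size_iota; lia.
rewrite mem_index_iota => lk; apply: pos_degZ.
  by rewrite ltr0n bin_gt0; lia.
(* Whatever [l] is, the factors have degrees l - 2 and k - l - 2, so all summands have degree k -
   4. *)
have -> : (k - 4 = (l.+1 - 3) + ((k - l).+1 - 3))%N by lia.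
by apply: pos_degM; apply: IH; lia.
Qed.

(** Index 2 is separate because p_2 = x is not a polynomial multiple of x^2. *)
Definition ppol k : {poly R} := if k == 2%N then 'X else 'X^k * qpol k.

Lemma ppolE k : (3 <= k)%N -> ppol k = 'X^k * qpol k.
Proof. by rewrite /ppol; case: eqP => // ->. Qed.

Lemma ppol2 : ppol 2 = 'X. Proof. by []. Qed.

Lemma ppol3 : ppol 3 = 'X^3.
Proof. by rewrite ppolE // qpol3 mulr1. Qed.

Lemma ppol4 : ppol 4 = 3 *: 'X^5 - 2 *: 'X^4.
Proof.
by rewrite ppolE // qpol4 mulrBr -scalerAr -exprSr mulrC mul_polyC.
Qed.

Lemma size_qpol k : (3 <= k)%N -> size (qpol k) = (k - 3).+1.
Proof. by move=> k3; exact: pos_deg_size (qpol_pos_deg k3). Qed.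

Lemma size_ppol k : (2 <= k)%N -> size (ppol k) = (2 * k - 3).+1.
Proof.
move=> k2; have [->|k3] : k = 2%N \/ (3 <= k)%N by lia.
  by rewrite ppol2 size_polyX.
rewrite ppolE // size_mul -?size_poly_eq0 ?size_polyXn ?size_qpol //; lia.
Qed.

Lemma ppol1 k : (2 <= k)%N -> (ppol k).[1] = 1.
Proof.
move=> k2; have [->|k3] : k = 2%N \/ (3 <= k)%N by lia.
  by rewrite ppol2 hornerX.
by rewrite ppolE // hornerM hornerXn expr1n mul1r qpol1.
Qed.

(* The summands [l = 1] and [l = k - 1] contain the unknown itself. *)
Lemma sum_ends (f : nat -> R) k : (3 <= k)%N ->
  \sum_(1 <= l < k) f l = f 1%N + \sum_(2 <= l < k.-1) f l + f k.-1.
Proof. by case: k => [|[|k]] // k3; rewrite big_ltn // big_nat_recr //= addrA. Qed.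

(** The two end summands together give k p_k / x, the derivative falling on the factor x^k; the
    middle ones give x^k q_k'. *)
Lemma ppol_rec : p_recursion ppol.
Proof.
move=> k k2; split=> [|x x0]; first exact: ppol1.
have [->|k3] : k = 2%N \/ (3 <= k)%N by lia.
  rewrite big_nat1 (_ : (2 - 1).+1 = 2)%N // !ppol2 derivX hornerX hornerC.
  by rewrite bin1; field.
rewrite sum_ends // (_ : (k - 1).+1 = k)%N; last by lia.
rewrite (_ : k.-1.+1 = k)%N; last by lia.
have -> : 'C(k, k.-1) = k by case: (k) k3 => // j _; rewrite binSn.
have -> : (k - k.-1 = 1)%N by lia.
rewrite bin1 ppol2 hornerX ppolE // derivM derivXn hornerD !hornerM.
rewrite qpol_deriv ?horner_q_rhs; last by lia.
rewrite hornerMn !hornerXn.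
have -> : \sum_(2 <= l < k.-1) 'C(k, l)%:R * (ppol l.+1).[x] * (ppol (k - l).+1).[x]
    = x ^+ k.+2 * \sum_(2 <= l < (k - 2).+1)
        'C(k, l)%:R * (qpol l.+1).[x] * (qpol (k - l).+1).[x].
  rewrite mulr_sumr (_ : (k - 2).+1 = k.-1)%N; last by lia.
  apply: eq_big_nat => l lk; rewrite !ppolE; try lia.
  rewrite !hornerM !hornerXn (_ : k.+2 = l.+1 + (k - l).+1)%N; last by lia.
  by rewrite exprD; ring.
have [j ->] : exists j, k = j.+1 by exists k.-1; lia.
by rewrite /= !exprS -mulr_natl; field.
Qed.

Lemma p_recursion_uniq (p' : nat -> {poly R}) : p_recursion p' ->
  forall k, (2 <= k)%N -> p' k = ppol k.
Proof.
move=> p'rec k; have [m km] := ubnP k; elim: m k km => // m IH k km k2.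
have [->|k3] : k = 2%N \/ (3 <= k)%N by lia.
  have [u1 du] := p'rec 2%N isT; rewrite ppol2; set u := p' 2%N in u1 du *.
  (* For k = 2 the recursion is the nonlinear equation u^2 = x^2 u'. Comparing sizes bounds the
     degree by 1, and the values at 0 and 1 then leave only ['X]. *)
  have u2 : u ^+ 2 = 'X^2 * u^`().
    apply: horner_inj => x x0; rewrite horner_exp hornerM hornerXn du //.
    by rewrite big_nat1 (_ : (2 - 1).+1 = 2)%N // -/u bin1; field.
  have us : (size u <= 2)%N.
    have u0 : u != 0.
      apply/eqP => u0; move: u1; rewrite u0 horner0 => /eqP.
      by rewrite eq_sym oner_eq0.
    have /= := congr1 (fun w : {poly R} => size w) u2; rewrite expr2 size_mul //.
    have := size_mul_leq 'X^2 u^`(); rewrite size_polyXn.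
    have := lt_size_deriv u0; rewrite /=.
    by move: (size ('X^2 * u^`())) (size u^`()) (size u) => a b c; lia.
  have u00 : u.[0] = 0.
    have := congr1 (fun w : {poly R} => w.[0]) u2.
    rewrite horner_exp hornerM hornerXn expr0n mul0r => /eqP.
    by rewrite expf_eq0 => /eqP.
  have uE : u = (u`_0)%:P + u`_1 *: 'X.
    apply/polyP => -[|[|i]]; rewrite coefD coefC coefZ coefX /= ?mulr0 ?mulr1 ?addr0 ?add0r //.
    by rewrite nth_default // (leq_trans us).
  have u000 : u`_0 = 0 by rewrite -horner_coef0.
  move: u1; rewrite uE u000 add0r hornerZ hornerX mulr1 => ->.
  by rewrite scale1r.
have [u1 du] := p'rec k k2; have [v1 dv] := ppol_rec k2.
set D := p' k - ppol k.
have D1 : D.[1] = 0 by rewrite hornerD hornerN u1 v1 subrr.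
(* By induction only the end summands differ, so D solves x D' = k D. Hence it is a multiple of x^k,
   and it vanishes at 1. *)
have XD : 'X * D^`() = k%:R *: D.
  apply: horner_inj => x x0.
  rewrite hornerM hornerX hornerZ derivB hornerD hornerN du // dv // !sum_ends //.
  rewrite (@eq_big_nat _ _ _ _ _ _ (fun l =>
    'C(k, l)%:R * (ppol l.+1).[x] * (ppol (k - l).+1).[x])); last first.
    by move=> l lk; rewrite !IH //; lia.
  rewrite (_ : (k - 1).+1 = k)%N; last by lia.
  rewrite (_ : k.-1.+1 = k)%N; last by lia.
  have -> : 'C(k, k.-1) = k by case: (k) k3 => // j _; rewrite binSn.
  have -> : (k - k.-1 = 1)%N by lia.
  rewrite bin1 (IH 2%N) //; last by lia.
  by rewrite ppol2 hornerX /D hornerD hornerN; field.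
apply/eqP; rewrite -subr_eq0 -/D; apply/eqP/polyP => i; rewrite coef0.
have Di j : j != k -> D`_j = 0.
  move=> jk; have := congr1 (fun w : {poly R} => w`_j) XD.
  rewrite coefXM coefZ coef_deriv; case: j jk => [|j] jk /=.
    by move/esym/eqP; rewrite mulf_eq0 pnatr_eq0 => /orP[|/eqP //]; lia.
  rewrite -[LHS]mulr_natl => /eqP; rewrite -subr_eq0 -mulrBl mulf_eq0 subr_eq0 eqr_nat.
  by rewrite (negbTE jk) => /eqP.
have DE : D = D`_k *: 'X^k.
  apply/polyP => j; rewrite coefZ coefXn; case: eqVneq => [->|/Di ->].
    by rewrite mulr1.
  by rewrite mulr0.
by move: D1; rewrite {1}DE hornerZ hornerXn expr1n mulr1 => Dk; rewrite DE Dk scale0r coef0.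
Qed.

End Polynomials.

(** * Calculus *)

Section Calculus.
Context (R : realType).
Implicit Types (f g df dg : R -> R) (x a b c : R).

Notation der f x a := (is_derive (x : R) (1 : R) (f : R -> R) (a : R)).

Lemma derC c x : der (fun=> c) x 0.
Proof. exact: is_derive_cst. Qed.

Lemma derD f g x a b : der f x a -> der g x b -> der (fun y => f y + g y) x (a + b).
Proof. exact: is_deriveD. Qed.

Lemma derB f g x a b : der f x a -> der g x b -> der (fun y => f y - g y) x (a - b).
Proof. exact: is_deriveB. Qed.

Lemma derM f g x a b : der f x a -> der g x b ->
  der (fun y => f y * g y) x (a * g x + f x * b).
Proof.
move=> fa gb; have := is_deriveM fa gb.
by rewrite addrC [g x *: a]mulrC.
Qed.

Lemma derZ f c x a : der f x a -> der (fun y => c * f y) x (c * a).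
Proof. exact: is_deriveZ. Qed.

Lemma derX f m x a : der f x a -> der (fun y => f y ^+ m) x (m%:R * f x ^+ m.-1 * a).
Proof.
move=> fa; rewrite (_ : (fun _ => _) = f ^+ m); first exact: is_deriveX.
by rewrite exprfctE.
Qed.

Lemma der_sum (I : Type) (r : seq I) (F : I -> R -> R) (dF : I -> R) x :
  (forall i, der (F i) x (dF i)) ->
  der (fun y => \sum_(i <- r) F i y) x (\sum_(i <- r) dF i).
Proof.
move=> FdF; elim: r => [|i r IH].
  rewrite big_nil (_ : (fun _ => _) = fun=> 0); first exact: derC.
  by apply/funext => y; rewrite big_nil.
rewrite big_cons (_ : (fun _ => _) = (fun y => F i y + \sum_(j <- r) F j y)).
  exact: derD.
by apply/funext => y; rewrite big_cons.
Qed.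

Lemma der_horner (u : {poly R}) f x a : der f x a ->
  der (fun y => u.[f y]) x (u^`().[f x] * a).
Proof. by move=> fa; exact: (@is_derive1_comp _ (horner u) f). Qed.

Lemma derV f x a : f x != 0 -> der f x a ->
  der (fun y => (f y)^-1) x (- (f x)^-1 ^+ 2 * a).
Proof. by move=> fx0 fa; rewrite exprVn; exact: is_deriveV. Qed.

Lemma le_of_der f df a b : a <= b ->
  (forall x, a <= x <= b -> der f x (df x)) ->
  (forall x, a <= x <= b -> 0 <= df x) -> f a <= f b.
Proof.
move=> ab fdf df0.
have fdf' x : x \in `[a, b] -> der f x (df x) by rewrite in_itv /=; exact: fdf.
have cf : {within `[a, b]%classic, continuous f}%classic.
  by apply: derivable_within_continuous => x /fdf' [].
have fdf'' x : x \in `]a, b[ -> der f x (df x).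
  by move=> /subset_itv_oo_cc; exact: fdf'.
have [x] := MVT_segment ab fdf'' cf.
rewrite in_itv /= => xab E; rewrite -subr_ge0 E.
by rewrite mulr_ge0 ?subr_ge0 // df0.
Qed.

Lemma horner_ge1_bound (u : {poly R}) m : (size u <= m.+1)%N ->
  exists2 B : R, 0 <= B & forall x, 1 <= x -> u.[x] <= B * x ^+ m.
Proof.
move=> um; exists (\sum_(i < size u) `|u`_i|) => [|x x1].
  by apply: sumr_ge0.
rewrite horner_coef mulr_suml; apply: ler_sum => i _.
apply: le_trans (ler_norm _) _; rewrite normrM ler_wpM2l //.
rewrite normrX ger0_norm ?(le_trans ler01) // ler_weXn2l //.
by rewrite -ltnS (leq_trans (ltn_ord i)).
Qed.

(** Of the derivative only the summand l = 2, that is q_3 q_(k-1), is kept and integrated from 1.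
    The bound serves to turn the absolute error into a relative one. *)
Lemma qpol_ge (k : nat) : (3 <= k)%N ->
  exists2 c : R, 0 < c & forall x, 1 <= x -> c * x ^+ (k - 3) <= (@qpol R k).[x].
Proof.
have [m km] := ubnP k; elim: m k km => // m IH k km k3.
have [k4|k4] := leqP k 3.
  have -> : k = 3%N by lia.
  by exists 1 => // x _; rewrite qpol3 hornerC mulr1.
have [c1 c1_gt0 qc1] := IH 3%N ltac:(lia) isT.
have [c2 c2_gt0 qc2] := IH (k - 1)%N ltac:(lia) ltac:(lia).
pose j := (k - 4)%N; have -> : (k - 3 = j.+1)%N by rewrite /j; lia.
(* The first entry serves the comparison at 1, where q_k = 1; the second serves the comparison of
   derivatives. *)
pose c := Num.min 1 (2^-1 * c1 * c2 / j.+1%:R).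
have c_gt0 : 0 < c by rewrite lt_min ltr01 /= !mulr_gt0 ?invr_gt0.
exists c => // x x1.
have dq y : 1 <= y -> c * j.+1%:R * y ^+ j <= (q_rhs (@qpol R) k).[y].
  move=> y1; have y0 : 0 <= y by rewrite (le_trans ler01).
  have q_ge0 i : (3 <= i < k)%N -> 0 <= (@qpol R i).[y].
    move=> ik; have [c' c'0 /(_ y y1)] := IH i ltac:(lia) ltac:(lia).
    by apply: le_trans; rewrite mulr_ge0 ?exprn_ge0 // ltW.
  rewrite horner_q_rhs.
  apply: (@le_trans _ _ (2^-1 * ('C(k, 2)%:R * (@qpol R 3).[y] * (@qpol R (k - 2).+1).[y]))).
    apply: (@le_trans _ _ (2^-1 * c1 * c2 * y ^+ j)).
      rewrite ler_wpM2r ?exprn_ge0 //.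
      by rewrite -ler_pdivlMr ?ltr0n // ge_min lexx orbT.
    rewrite -!mulrA ler_wpM2l ?invr_ge0 //.
    have -> : ((k - 2).+1 = k - 1)%N by lia.
    have := qc1 y y1; have := qc2 y y1; rewrite mulr1 (_ : (k - 1 - 3)%N = j); last by rewrite /j; lia.
    move=> h2 h1; rewrite mulrA.
    apply: (@le_trans _ _ ((@qpol R 3).[y] * (@qpol R (k - 1)).[y])).
      by rewrite -mulrA ler_pM // ?mulr_ge0 ?exprn_ge0 // ltW.
    rewrite ler_peMl ?mulr_ge0 ?q_ge0 //; try lia.
    by rewrite ler1n bin_gt0; lia.
  rewrite ler_wpM2l ?invr_ge0 // big_ltn; last by lia.
  rewrite lerDl; rewrite big_nat; apply: sumr_ge0 => l lk.
  by rewrite !mulr_ge0 // q_ge0; lia.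
rewrite -subr_ge0.
apply: (@le_trans _ _ ((@qpol R k).[1] - c * 1 ^+ j.+1)).
  by rewrite qpol1 expr1n mulr1 subr_ge0 ge_min lexx.
apply: (@le_of_der (fun y => (@qpol R k).[y] - c * y ^+ j.+1)
  (fun y => (@qpol R k)^`().[y] - c * (j.+1%:R * y ^+ j))) => // y /andP[y1 _].
  apply: derB.
  apply: derZ; rewrite -[_ * _ ^+ j]mulr1; apply: derX; exact: is_derive_id.
by rewrite subr_ge0 mulrA qpol_deriv ?dq //; lia.
Qed.

Lemma ppol_ge (k : nat) : (2 <= k)%N ->
  exists2 c : R, 0 < c & forall x, 1 <= x -> c * x ^+ (2 * k - 3) <= (@ppol R k).[x].
Proof.
move=> k2; have [->|k3] : k = 2%N \/ (3 <= k)%N by lia.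
  by exists 1 => // x _; rewrite ppol2 hornerX mul1r.
have [c c0 qc] := qpol_ge k3; exists c => // x x1.
rewrite ppolE // hornerM hornerXn (_ : (2 * k - 3 = k + (k - 3))%N); last by lia.
by rewrite exprD mulrCA ler_wpM2l ?qc // exprn_ge0 // (le_trans ler01).
Qed.

Lemma ppol_ge0 (k : nat) x : (2 <= k)%N -> 1 <= x -> 0 <= (@ppol R k).[x].
Proof.
move=> k2 x1; have [c c0 /(_ x x1)] := ppol_ge k2.
by apply: le_trans; rewrite mulr_ge0 ?exprn_ge0 ?(ltW c0) // (le_trans ler01).
Qed.

End Calculus.

(** * Comparison with the limiting system *)

Section Comparison.
Context (R : realType).

Notation der f x a := (is_derive (x : R) (1 : R) (f : R -> R) (a : R)).

Definition conv (k : nat) (f : nat -> R) : R :=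
  2^-1 * \sum_(1 <= l < k) 'C(k, l)%:R * (f l.+1 * f (k - l).+1).

Lemma conv2 f : conv 2 f = f 2%N ^+ 2.
Proof. by rewrite /conv big_nat1 (_ : (2 - 1).+1 = 2)%N // bin1; field. Qed.

(** Isolates the part linear in [f k]; all indices in the remaining sum lie strictly between 2 and
    k. *)
Lemma conv_ends k f : (3 <= k)%N -> conv k f = k%:R * (f 2%N * f k) +
  2^-1 * \sum_(2 <= l < k.-1) 'C(k, l)%:R * (f l.+1 * f (k - l).+1).
Proof.
move=> k3; rewrite /conv sum_ends // (_ : (k - 1).+1 = k)%N; last by lia.
rewrite (_ : k.-1.+1 = k)%N; last by lia.
have -> : 'C(k, k.-1) = k by case: (k) k3 => // j _; rewrite binSn.
have -> : (k - k.-1 = 1)%N by lia.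
by rewrite bin1; field.
Qed.

(* Differential inequalities satisfied by the functions [F k t = E S_k(t)],
   with the term [- F (k + 2)] bounding the effect of the covariances and of
   the edges falling inside a component. *)
Record sk_system (n : nat) (F dF : nat -> R -> R) : Prop := SkSystem {
  sk_init : forall k, (2 <= k)%N -> F k 0 = n%:R;
  sk_ge0 : forall k t, 0 <= t -> 0 <= F k t;
  sk_gt0 : forall t, 0 <= t -> 0 < F 2%N t;
  sk_der : forall k t, (2 <= k)%N -> der (F k) t (dF k t);
  sk_le : forall k t, (2 <= k)%N -> 0 <= t -> dF k t <= conv k (F^~ t);
  sk_ge : forall k t, (2 <= k)%N -> 0 <= t ->
    conv k (F^~ t) - (2^-1 * \sum_(1 <= l < k) 'C(k, l)%:R) * F k.+2 t <= dF k t
}.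

Section Limit.
Context (n : nat) (n_gt0 : (0 < n)%N).

Definition xt (t : R) : R := (1 - n%:R * t)^-1.

Definition limS (k : nat) (t : R) : R := n%:R * (@ppol R k).[xt t].

Lemma xt0 : xt 0 = 1. Proof. by rewrite /xt mulr0 subr0 invr1. Qed.

Lemma limS0 k : (2 <= k)%N -> limS k 0 = n%:R.
Proof. by move=> k2; rewrite /limS xt0 ppol1 // mulr1. Qed.

Lemma limS2 t : limS 2 t = n%:R * xt t.
Proof. by rewrite /limS ppol2 hornerX. Qed.

Context (t : R) (nt1 : n%:R * t < 1).

Lemma yt_gt0 : 0 < 1 - n%:R * t. Proof. by rewrite subr_gt0. Qed.

Lemma yt_neq0 : 1 - n%:R * t != 0. Proof. by rewrite gt_eqF ?yt_gt0. Qed.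

Lemma xt_gt0 : 0 < xt t. Proof. by rewrite invr_gt0 yt_gt0. Qed.

Lemma xt_ge1 : 0 <= t -> 1 <= xt t.
Proof. by move=> t0; rewrite invf_ge1 ?yt_gt0 // gerBl mulr_ge0. Qed.

Lemma der_yt : der (fun s => 1 - n%:R * s) t (- n%:R).
Proof.
rewrite -[- n%:R]add0r -[in X in is_derive _ _ _ X](mulr1 n%:R).
by apply: derB; apply: derZ; exact: is_derive_id.
Qed.

Lemma der_xt : der xt t (n%:R * xt t ^+ 2).
Proof.
rewrite (_ : n%:R * _ = - xt t ^+ 2 * - n%:R); last by ring.
apply: derV der_yt; exact: yt_neq0.
Qed.

(** For x = 1/(1 - n t) one has x' = n x^2, which cancels the factor 1/x^2 in the recursion for
    p_k'. *)
Lemma der_limS k : (2 <= k)%N -> der (limS k) t (conv k (limS^~ t)).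
Proof.
move=> k2; rewrite (_ : conv _ _ =
    n%:R * ((@ppol R k)^`().[xt t] * (n%:R * xt t ^+ 2))).
  by apply: derZ; apply: der_horner; exact: der_xt.
have x0 : xt t != 0 by rewrite gt_eqF ?xt_gt0.
have [_ ->] := @ppol_rec R k k2; last by [].
rewrite /conv /limS.
rewrite (_ : \sum_(1 <= l < k) _ = n%:R ^+ 2 * \sum_(1 <= l < k)
   'C(k, l)%:R * (@ppol R l.+1).[xt t] * (@ppol R (k - l).+1).[xt t]).
  by field.
by rewrite mulr_sumr; apply: eq_bigr => l _; ring.
Qed.

(* (1 - n t)^k is the integrating factor of f' = k (limS 2) f. *)
Lemma der_weighted k f df : (0 < k)%N -> der f t df ->
  der (fun s => (1 - n%:R * s) ^+ k * f s) t
      ((1 - n%:R * t) ^+ k * (df - k%:R * limS 2 t * f t)).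
Proof.
case: k => // k _ fdf.
rewrite (_ : _ * (_ - _) = k.+1%:R * (1 - n%:R * t) ^+ k * - n%:R * f t +
   (1 - n%:R * t) ^+ k.+1 * df).
  by apply: derM fdf; apply: (@derX _ _ k.+1); exact: der_yt.
rewrite limS2 /xt exprS; have := yt_neq0.
by move: (1 - _) => y y0; field.
Qed.

Lemma limS_ge0 k : (2 <= k)%N -> 0 <= t -> 0 <= limS k t.
Proof. by move=> k2 t0; rewrite mulr_ge0 // ppol_ge0 // xt_ge1. Qed.

End Limit.

(** * Upper bound for the solutions of the system *)

Section UpperBound.
Context (n : nat) (n_gt0 : (0 < n)%N) (F dF : nat -> R -> R).
Context (FdF : sk_system n F dF).

Lemma mulr_nt_lt1 s t : s <= t -> n%:R * t < 1 -> n%:R * s < 1 :> R.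
Proof. by move=> st; apply: le_lt_trans; rewrite ler_wpM2l. Qed.

(** From F_2' <= F_2^2 it follows that t + 1/F_2 is nondecreasing, with initial value 1/n. *)
Lemma sk_le_limS2 t : 0 <= t -> n%:R * t < 1 -> F 2 t <= limS n 2 t.
Proof.
move=> t0 nt1.
have n0 : 0 < n%:R :> R by rewrite ltr0n.
have F2 s : 0 <= s -> 0 < F 2 s by exact: (sk_gt0 FdF).
have : 0 + (F 2 0)^-1 <= t + (F 2 t)^-1.
  apply: (@le_of_der R (fun s => s + (F 2 s)^-1)
    (fun s => 1 + - (F 2 s)^-1 ^+ 2 * dF 2 s)) => // s /andP[s0 _].
    apply: derD; apply: derV; first by rewrite gt_eqF ?F2.
    exact: (sk_der FdF).
  have := sk_le FdF (isT : (2 <= 2)%N) s0; rewrite conv2 => dF2.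
  have Fs := F2 _ s0.
  by rewrite mulNr subr_ge0 exprVn mulrC ler_pdivrMr ?exprn_gt0 // mul1r.
rewrite (sk_init FdF) // add0r => h.
have ynt := yt_gt0 nt1.
have : (1 - n%:R * t) / n%:R <= (F 2 t)^-1.
  by rewrite mulrBl mul1r [n%:R * t]mulrC mulfK ?gt_eqF // lerBlDl.
rewrite -lef_pV2 ?posrE ?invr_gt0 ?F2 ?divr_gt0 //.
by rewrite invrK invf_div limS2.
Qed.

(** Induction on [k]: the difference, weighted by (1 - n t)^k, starts at 0 and has nonnegative
    derivative. *)
Lemma sk_le_limS k t : (2 <= k)%N -> 0 <= t -> n%:R * t < 1 ->
  F k t <= limS n k t.
Proof.
have [m km] := ubnP k; elim: m k km t => // m IH k km t k2 t0 nt1.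
have [->|k3] : k = 2%N \/ (3 <= k)%N by lia.
  exact: sk_le_limS2.
pose h s := (1 - n%:R * s) ^+ k * (limS n k s - F k s).
suff : 0 <= h t.
  by rewrite /h pmulr_rge0 ?exprn_gt0 ?yt_gt0 // subr_ge0.
rewrite (_ : 0 = h 0); last by rewrite /h limS0 // (sk_init FdF) // subrr mulr0.
apply: (@le_of_der R h (fun s => (1 - n%:R * s) ^+ k *
  (conv k (limS n ^~ s) - dF k s - k%:R * limS n 2 s * (limS n k s - F k s)))) => //
  s /andP[s0 st]; have ns1 := mulr_nt_lt1 st nt1.
  apply: der_weighted => //; first by lia.
  by apply: derB; [exact: der_limS|exact: (sk_der FdF)].
apply: mulr_ge0; first by rewrite exprn_ge0 // ltW ?yt_gt0.
apply: (@le_trans _ _ (conv k (limS n ^~ s) - conv k (F ^~ s) -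
    k%:R * limS n 2 s * (limS n k s - F k s))); last first.
  by rewrite lerD2r lerD2l lerN2 (sk_le FdF).
rewrite !conv_ends //; set A := \sum_(_ <= _ < _) _; set B := \sum_(_ <= _ < _) _.
have F2 := sk_le_limS2 s0 ns1.
have Fk := sk_ge0 FdF k s0.
have BA : B <= A.
  apply: ler_sum_nat => l lk; rewrite ler_wpM2l // ler_pM ?(sk_ge0 FdF) // IH //; lia.
(* The integrating factor removes the term in P_k - F_k; what remains of the linear part is k (P_2 -
   F_2) F_k. *)
rewrite [X in 0 <= X](_ : _ = k%:R * ((limS n 2 s - F 2 s) * F k s) + 2^-1 * (A - B)).
  by rewrite addr_ge0 ?mulr_ge0 ?subr_ge0.
by ring.
Qed.

End UpperBound.

(** * Lower bound, with constants independent of n *)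

Lemma limS_bound k : (2 <= k)%N -> exists2 B : R, 0 <= B &
  forall (n : nat) t, 0 <= t -> n%:R * t < 1 ->
    limS n k t <= B * (n%:R * xt n t ^+ (2 * k - 3)).
Proof.
move=> k2; have [|B B0 pB] := @horner_ge1_bound R (@ppol R k) (2 * k - 3).
  by rewrite size_ppol.
exists B => // n t t0 nt1; by rewrite mulrCA ler_wpM2l // pB // xt_ge1.
Qed.

(** Induction on [k]: the weighted difference is compared with a multiple of n t x^k, where x = 1/(1
    - n t). *)
Lemma sk_ge_limS k : (2 <= k)%N -> exists2 K : R, 0 <= K &
  forall (n : nat) F dF t, (0 < n)%N -> sk_system n F dF ->
    0 <= t -> n%:R * t < 1 ->
    limS n k t - F k t <= K * (n%:R * t * xt n t ^+ (2 * k)).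
Proof.
have [m km] := ubnP k; elim: m k km => // m IH k km k2.
have idx l : (2 <= l < k.-1)%N -> [/\ (2 <= l.+1 < k)%N,
    (2 <= (k - l).+1 < k)%N & (l.+1 + (k - l).+1 = k.+2)%N].
  by move=> lk; split; lia.
(* One sequence of constants for all indices, set to 0 where no bound is claimed. *)
have [B B0 limB] : exists2 B : nat -> R, (forall j, 0 <= B j) &
    forall j, (2 <= j)%N -> forall (n : nat) t, 0 <= t -> n%:R * t < 1 ->
      limS n j t <= B j * (n%:R * xt n t ^+ (2 * j - 3)).
  have /choice[B hB] j : exists B : R, 0 <= B /\ ((2 <= j)%N ->
      forall (n : nat) t, 0 <= t -> n%:R * t < 1 ->
      limS n j t <= B * (n%:R * xt n t ^+ (2 * j - 3))).
    have [j2|j2] := leqP 2 j; last by exists 0; split.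
    by have [b b0 hb] := limS_bound j2; exists b.
  by exists B => j; have [] := hB j.
have [K K0 limK] : exists2 K : nat -> R, (forall j, 0 <= K j) &
    forall j, (2 <= j < k)%N -> forall (n : nat) F dF t, (0 < n)%N ->
      sk_system n F dF -> 0 <= t -> n%:R * t < 1 ->
      limS n j t - F j t <= K j * (n%:R * t * xt n t ^+ (2 * j)).
  have /choice[K hK] j : exists K : R, 0 <= K /\ ((2 <= j < k)%N ->
      forall (n : nat) F dF t, (0 < n)%N ->
      sk_system n F dF -> 0 <= t -> n%:R * t < 1 ->
      limS n j t - F j t <= K * (n%:R * t * xt n t ^+ (2 * j))).
    case: (boolP (2 <= j < k)%N) => [/andP[j2 jk]|_]; last by exists 0.
    by have [b b0 hb] := IH j (leq_trans jk km) j2; exists b.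
  by exists K => j; have [] := hK j.
pose s := 2^-1 * \sum_(1 <= l < k) 'C(k, l)%:R : R.
have s0 : 0 <= s by rewrite mulr_ge0 ?sumr_ge0.
(* [c] collects the bounds on the products P_i P_j - F_i F_j from smaller indices, and [s] is the
   coefficient of the perturbation F_(k+2). *)
pose c := k%:R * (K 2%N * B k) + 2^-1 * \sum_(2 <= l < k.-1)
  'C(k, l)%:R * (K l.+1 * B (k - l).+1 + B l.+1 * K (k - l).+1).
have c0 : 0 <= c.
  rewrite addr_ge0 ?mulr_ge0 ?K0 ?B0 // sumr_ge0 // => l _.
  by rewrite mulr_ge0 // addr_ge0 // mulr_ge0.
pose M := c + s * B k.+2.
have M0 : 0 <= M by rewrite addr_ge0 // mulr_ge0.
exists M => // n F dF t n0 FdF t0 nt1.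
have bnd u : 0 <= u -> n%:R * u < 1 ->
    conv k (limS n ^~ u) - dF k u - k%:R * limS n 2 u * (limS n k u - F k u)
    <= M * (n%:R * xt n u ^+ (2 * k).+1).
  move=> u0 nu1; set x := xt n u; have x1 : 1 <= x by exact: xt_ge1.
  have x0 : 0 <= x by rewrite (le_trans ler01).
  have FP j : (2 <= j)%N -> F j u <= limS n j u by move=> j2; exact: (sk_le_limS n0 FdF).
  have FB j : (2 <= j)%N -> limS n j u <= B j * (n%:R * x ^+ (2 * j - 3)).
    by move=> j2; exact: limB.
  have F0 j : 0 <= F j u by exact: (sk_ge0 FdF).
  have GK j : (2 <= j < k)%N -> limS n j u - F j u <= K j * x ^+ (2 * j).
    move=> jk; apply: le_trans (limK _ jk _ _ _ _ n0 FdF u0 nu1) _.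
    by rewrite ler_wpM2l // ler_piMl ?exprn_ge0 // ltW.
  have GB i j : (2 <= i < k)%N -> (2 <= j)%N -> (i + j = k.+2)%N ->
      (limS n i u - F i u) * limS n j u <= K i * B j * (n%:R * x ^+ (2 * k).+1).
    move=> ik j2 ij; rewrite (_ : (2 * k).+1 = 2 * i + (2 * j - 3))%N; last by lia.
    rewrite exprD (_ : K i * B j * _ = K i * x ^+ (2 * i) * (B j * (n%:R * x ^+ (2 * j - 3)))); last by ring.
    apply: ler_pM; rewrite ?GK ?FB ?subr_ge0 ?FP ?limS_ge0 //; lia.
  apply: (@le_trans _ _ (conv k (limS n ^~ u) - conv k (F ^~ u) + s * F k.+2 u -
      k%:R * limS n 2 u * (limS n k u - F k u))).
    rewrite lerD2r -[leRHS]addrA lerD2l lerNl opprD opprK.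
    by rewrite [leLHS](_ : _ = conv k (F^~ u) - s * F k.+2 u) ?(sk_ge FdF) //; ring.
  have sF : s * F k.+2 u <= s * B k.+2 * (n%:R * x ^+ (2 * k).+1).
    rewrite -mulrA ler_wpM2l // (le_trans (FP _ _)) // (le_trans (FB _ _)) //.
    by rewrite (_ : (2 * k.+2 - 3 = (2 * k).+1)%N) //; lia.
  rewrite /M mulrDl.
  suff : conv k (limS n ^~ u) - conv k (F ^~ u) -
      k%:R * limS n 2 u * (limS n k u - F k u) <= c * (n%:R * x ^+ (2 * k).+1).
    by move=> h; have := lerD h sF; apply: le_trans; rewrite addrAC lexx.
  have [k2E|k3] : k = 2%N \/ (3 <= k)%N by lia.
    rewrite k2E !conv2 in c0 *; apply: (@le_trans _ _ 0); last first.
      by rewrite mulr_ge0 // mulr_ge0 // exprn_ge0.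
    (* For k = 2 the two end summands coincide, and the nonlinear part is minus a square. *)
    rewrite [leLHS](_ : _ = - (limS n 2 u - F 2 u) ^+ 2); last by ring.
    by rewrite oppr_le0 sqr_ge0.
  rewrite !conv_ends //; set PA := \sum_(_ <= _ < _) _; set PB := \sum_(_ <= _ < _) _.
  rewrite [leLHS](_ : _ = k%:R * ((limS n 2 u - F 2 u) * F k u) + 2^-1 * (PA - PB)); last by ring.
  rewrite /c [leRHS]mulrDl; apply: lerD.
    rewrite -mulrA ler_wpM2l //.
    apply: (le_trans _ (GB 2%N k k3 k2 erefl)).
    by rewrite ler_wpM2l ?subr_ge0 ?FP.
  rewrite -[leRHS]mulrA ler_wpM2l ?invr_ge0 // -sumrB mulr_suml.
  apply: ler_sum_nat => l lk; rewrite -mulrBr -mulrA ler_wpM2l //.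
  rewrite (_ : _ - _ = (limS n l.+1 u - F l.+1 u) * limS n (k - l).+1 u +
     (limS n (k - l).+1 u - F (k - l).+1 u) * F l.+1 u); last by ring.
  have [l1 l2 l3] := idx l lk.
  have [l1' _] := andP l1; have [l2' _] := andP l2.
  have h1 := GB _ _ l1 l2' l3.
  have h2 := GB _ _ l2 l1' (etrans (addnC _ _) l3).
  rewrite [leRHS]mulrDl; apply: (lerD h1).
  rewrite [B l.+1 * _]mulrC; apply: (le_trans _ h2).
  by rewrite ler_wpM2l ?subr_ge0 ?FP.
(* After weighting, the bound of [bnd] becomes M n x^(k+1). The derivative of n u x^k is n x^(k+1)
   (1 - n u + k n u), which is at least n x^(k+1). *)
pose h u := M * (n%:R * u * xt n u ^+ k) - (1 - n%:R * u) ^+ k * (limS n k u - F k u).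
have h0 : 0 <= h t.
  rewrite (_ : 0 = h 0); last first.
    by rewrite /h limS0 // (sk_init FdF) // subrr !mulr0 mul0r mulr0 subr0.
  pose dh u := M * ((n%:R * 1) * xt n u ^+ k +
      n%:R * u * (k%:R * xt n u ^+ k.-1 * (n%:R * xt n u ^+ 2))) -
    (1 - n%:R * u) ^+ k * (conv k (limS n ^~ u) - dF k u -
      k%:R * limS n 2 u * (limS n k u - F k u)).
  apply: (@le_of_der R h dh 0 t t0) => u /andP[u0 ut];
    have nu1 := mulr_nt_lt1 ut nt1.
    apply: derB.
      have d1 : der (fun v => n%:R * v) u (n%:R * 1).
        by apply: derZ; exact: is_derive_id.
      exact: (derZ M (derM d1 (derX k (der_xt nu1)))).
    apply: der_weighted => //; first by lia.
    by apply: derB; [exact: der_limS|exact: (sk_der FdF)].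
  rewrite /dh subr_ge0.
  have y0 := yt_gt0 nu1.
  apply: (@le_trans _ _ ((1 - n%:R * u) ^+ k * (M * (n%:R * xt n u ^+ (2 * k).+1)))).
    by rewrite ler_wpM2l ?bnd // exprn_ge0 // ltW.
  have yx : (1 - n%:R * u) * xt n u = 1 by rewrite mulfV ?gt_eqF.
  rewrite (_ : (2 * k).+1 = k + k.+1)%N; last by lia.
  rewrite exprD (_ : _ * (M * _) = M * n%:R * xt n u ^+ k.+1 * ((1 - n%:R * u) * xt n u) ^+ k); last first.
    by rewrite exprMn; ring.
  rewrite yx expr1n !mulr1.
  have -> : n%:R * xt n u ^+ k + n%:R * u * (k%:R * xt n u ^+ k.-1 * (n%:R * xt n u ^+ 2))
      = n%:R * xt n u ^+ k.+1 * (1 - n%:R * u + n%:R * u * k%:R).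
    have [j ->] : exists j, k = j.+1 by exists k.-1; lia.
    have -> : 1 - n%:R * u = (xt n u)^-1 by rewrite invrK.
    have : xt n u != 0 by rewrite gt_eqF ?xt_gt0.
    by move: (xt n u) => x x0; rewrite /= !exprS; field.
  rewrite -mulrA ler_wpM2l // ler_peMr ?mulr_ge0 ?exprn_ge0 ?(ltW (xt_gt0 _)) //.
  by rewrite -addrA lerDl addrC subr_ge0 ler_peMr ?mulr_ge0 // ler1n; lia.
move: h0; rewrite /h subr_ge0 mulrC -ler_pdivlMr ?exprn_gt0 ?yt_gt0 // => /le_trans; apply.
by rewrite -exprVn -/(xt n t) mul2n -addnn exprD !mulrA.
Qed.

End Comparison.

(** * The system satisfied by the expected power sums *)

Section Process.
Context (R : realType).

Notation der f x a := (is_derive (x : R) (1 : R) (f : R -> R) (a : R)).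

(** Regrouping by the resulting set e |: H. The coefficient of [F H] is the time derivative of its
    weight when p' = 1 - p. *)
Lemma sum_mean_add (E : finType) (p : R) (F : {set E} -> R) :
  \sum_e mean p (fun H => F (e |: H)%SET - F H) =
  \sum_(H : {set E}) (#|H|%:R * (p ^+ #|H|.-1 * (1 - p) ^+ #|~: H|%SET.+1) -
    #|~: H|%SET%:R * weight p H) * F H.
Proof.
transitivity (\sum_e (\sum_(H : {set E} | e \notin H) weight p H * F (e |: H)%SET -
                      \sum_(H : {set E} | e \notin H) weight p H * F H)).
  apply: eq_bigr => e _; rewrite -sumrB /mean (bigID (fun H : {set E} => e \in H)) /=.
  rewrite big1 ?add0r; last first.
    move=> H eH; rewrite (_ : e |: H = H)%SET ?subrr ?mulr0 //.
    by apply/finset.setUidPr; rewrite finset.sub1set.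
  by apply: eq_bigr => H _; rewrite mulrBr.
rewrite sumrB; under [RHS]eq_bigr => H _ do rewrite mulrBl.
rewrite [RHS]sumrB; congr (_ - _); last first.
  rewrite (exchange_big_dep xpredT) //=; apply: eq_bigr => H _.
  rewrite (eq_bigl (fun e => e \in ~: H)%SET); last by move=> e; rewrite inE.
  by rewrite sumr_const -[LHS]mulr_natl mulrA.
transitivity (\sum_e \sum_(K : {set E} | e \in K) weight p (K :\ e)%SET * F K).
  apply: eq_bigr => e _.
  rewrite (reindex_onto (fun K : {set E} => K :\ e)%SET (fun H => e |: H)%SET) /=; last first.
    by move=> H eH; rewrite setU1K.
  apply: eq_big => [K|K /andP[_ /eqP ->]] //.
  rewrite setD11 /=; apply/eqP/idP => [<-|]; first by rewrite setU11.
  exact: finset.setD1K.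
rewrite (exchange_big_dep xpredT) //=; apply: eq_bigr => K _.
rewrite (eq_bigr (fun=> p ^+ #|K|.-1 * (1 - p) ^+ #|~: K|%SET.+1 * F K)).
  by rewrite sumr_const -[LHS]mulr_natl mulrA.
move=> e eK; congr (_ * _); rewrite /weight; congr (_ ^+ _ * _ ^+ _).
  by rewrite (cardsD1 e K) eK.
by rewrite finset.setCD finset.setUC cardsU1 inE eK.
Qed.

(** Kolmogorov's equation: with p = 1 - exp(-t), every absent edge arrives at rate 1, and edges
    already present contribute 0. *)
Lemma der_mean (E : finType) (F : {set E} -> R) (t : R) :
  der (fun s => mean (1 - expR (- s)) F) t
      (\sum_e mean (1 - expR (- t)) (fun H => F (e |: H)%SET - F H)).
Proof.
rewrite sum_mean_add; set p := fun s : R => 1 - expR (- s).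
have dN : der (fun s => - s) t (- 1) by apply: is_deriveN; exact: is_derive_id.
have dp : der p t (1 - p t).
  rewrite (_ : 1 - p t = 0 - expR (- t) * - 1); last by rewrite /p; ring.
  exact: derB (derC 1 t) (@is_derive1_comp _ expR _ _ _ _ (is_derive_expR _) dN).
have dq : der (fun s => 1 - p s) t (- (1 - p t)).
  by rewrite -[X in is_derive _ _ _ X]add0r; exact: derB (derC 1 t) dp.
apply: (@der_sum R _ _ (fun (H : {set E}) s => weight (p s) H * F H)) => H.
rewrite -[X in is_derive _ _ _ X]addr0 -(mulr0 (weight (p t) H)).
apply: derM (derC _ _); rewrite /weight.
set h := #|H|; set c := #|~: H|%SET.
rewrite (_ : _ - _ = h%:R * p t ^+ h.-1 * (1 - p t) * (1 - p t) ^+ c +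
    p t ^+ h * (c%:R * (1 - p t) ^+ c.-1 * - (1 - p t))).
  by apply: derM; [exact: (derX h dp)|exact: (derX c dq)].
rewrite -[1 - expR (- t)]/(p t).
by move: (p t) => q; case: c => [|c]; rewrite ?exprS /=; ring.
Qed.

Section System.
Context (n : nat) (n_gt0 : (0 < n)%N).

(** The expectation of S_k for positive [k]; the predecessor undoes the index shift of [cpow]. *)
Definition meanS (k : nat) (t : R) : R := mean (1 - expR (- t)) (@cpow R n k.-1).

Definition dmeanS (k : nat) (t : R) : R :=
  \sum_(e : edge n) mean (1 - expR (- t))
    (fun H => cpow R k.-1 (e |: H)%SET - cpow R k.-1 H).

Lemma mean_p0 (E : finType) (F : {set E} -> R) : mean 0 F = F finset.set0.
Proof.
rewrite /mean (bigD1 finset.set0) //= big1 ?addr0 => [|H H0].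
  by rewrite /weight cards0 expr0 subr0 expr1n !mul1r.
by rewrite /weight expr0n cards_eq0 (negbTE H0) !mul0r.
Qed.

Lemma cpow_set0 k : cpow R k (finset.set0 : {set edge n}) = n%:R.
Proof.
rewrite /cpow (eq_bigr (fun=> 1)); first by rewrite sumr_const card_ord.
move=> u _; rewrite /csize (_ : ccomp _ _ = [set u]%SET) ?cards1 ?expr1n //.
apply/eqP; rewrite finset.eqEsubset; apply/andP; split; last first.
  by rewrite finset.sub1set ccomp_refl.
apply: ccomp_sub; rewrite ?set11 // => x y _ /existsP[e].
by rewrite finset.in_set0 andbF.
Qed.

Lemma cpow_ge k (H : {set edge n}) : n%:R <= cpow R k H.
Proof.
rewrite -[in leLHS](card_ord n) -sumr_const; apply: ler_sum => u _.
by rewrite exprn_ege1 // csize_ge1.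
Qed.

Lemma dmeanSE k t : (2 <= k)%N -> dmeanS k t = 2^-1 * \sum_(1 <= l < k)
  'C(k, l)%:R * mean (1 - expR (- t)) (@cpow2 R n l (k - l)).
Proof.
move=> k2; rewrite /dmeanS -mean_sum.
under eq_mean => H do rewrite sum_cpow_add prednK ?(ltnW k2) //.
by rewrite meanZ mean_sum; under [in LHS]eq_bigr => l _ do rewrite meanZ.
Qed.

Lemma meanS_system : sk_system n meanS dmeanS.
Proof.
have p01 t : 0 <= t -> 0 <= 1 - expR (- t) <= (1 : R).
  by move=> t0; rewrite subr_ge0 -expR0 ler_expR oppr_le0 t0 gerBl expR_ge0.
have meanS_ge k t : 0 <= t -> n%:R <= meanS k t.
  move=> t0; have /andP[p0 p1] := p01 t t0.
  by rewrite -(mean_cst (edge n) (1 - expR (- t)) n%:R) le_mean // => H; exact: cpow_ge.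
split.
- by move=> k k2; rewrite /meanS oppr0 expR0 subrr mean_p0 cpow_set0.
- by move=> k t t0; rewrite (le_trans _ (meanS_ge k t t0)).
- by move=> t t0; rewrite (lt_le_trans _ (meanS_ge 2%N t t0)) // ltr0n.
- by move=> k t k2; exact: der_mean.
- move=> k t k2 t0; have /andP[p0 p1] := p01 t t0.
  rewrite dmeanSE // /conv ler_wpM2l ?invr_ge0 //; apply: ler_sum => l _.
  by rewrite ler_wpM2l // mean_cpow2_le.
- move=> k t k2 t0; have /andP[p0 p1] := p01 t t0.
  rewrite dmeanSE // /conv -mulrA -mulrBr ler_wpM2l ?invr_ge0 //.
  (* For every [l] the correction in Harris' bound has the same index l + (k - l) + 2 = k + 2, so it
     factors out of the sum. *)
  rewrite mulr_suml -sumrB; apply: ler_sum_nat => l lk.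
  rewrite -mulrBr ler_wpM2l // (le_trans _ (mean_cpow2_ge n p0 p1 _ _)) //.
  by rewrite /meanS /= subnKC //; lia.
Qed.

End System.

(** * From the system to the two forms of the expansion *)

Lemma ES_meanS (n k : nat) (t : R) (d : measure_display) (Omega : measurableType d)
    (P : probability Omega R) (T : edge n -> {RV P >-> R}) :
  (2 <= k)%N -> 0 <= t -> is_edge_times T -> ES k T t = (meanS n k t)%:E.
Proof.
by move=> k2 t0 Tt; rewrite /meanS -(ES_mean _ Tt t0) prednK // ltnW.
Qed.

Lemma ES_expansion_ext (k : nat) (rhs1 rhs2 : nat -> R -> R -> R) (bound : nat -> R -> R) :
  (forall n t eps, 0 < 1 - n%:R * t -> rhs1 n t eps = rhs2 n t eps) ->
  ES_expansion k rhs1 bound -> ES_expansion k rhs2 bound.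
Proof.
move=> rhsE [K hK]; exists K => n t n1 t0 tn d Omega P T Tt.
have [eps [epsK ESE]] := hK n t n1 t0 tn d Omega P T Tt.
exists eps; split=> //; rewrite ESE rhsE // subr_gt0.
by rewrite -[ltRHS](@mulfV _ n%:R) ?pnatr_eq0 -?lt0n // ltr_pM2l // ltr0n.
Qed.

Lemma ES_expansion_add k : (2 <= k)%N -> ES_expansion k
  (fun n t eps => n%:R * (@ppol R k).[1 / (1 - n%:R * t)] + eps)
  (fun n t => n%:R * t / (1 - n%:R * t) ^+ (2 * k)).
Proof.
move=> k2; have [K K0 hK] := sk_ge_limS R k2; exists K => n t n1 t0 tn d Omega P T Tt.
have nt1 : n%:R * t < 1.
  by rewrite -[ltRHS](@mulfV _ n%:R) ?pnatr_eq0 -?lt0n // ltr_pM2l // ltr0n.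
exists (meanS n k t - limS n k t); split; last first.
  by rewrite (ES_meanS k2 t0 Tt) /limS /xt div1r subrKC.
have sys := meanS_system n1.
rewrite distrC ger0_norm ?subr_ge0 ?(sk_le_limS n1 sys) //.
by have := hK _ _ _ _ n1 sys t0 nt1; rewrite /xt exprVn.
Qed.

(** The additive error is divided by n p_k(x), which is at least c n x^(2k-3); of the power x^(2k)
    this leaves x^3. *)
Lemma ES_expansion_mul k : (2 <= k)%N -> ES_expansion k
  (fun n t eps => n%:R * (@ppol R k).[1 / (1 - n%:R * t)] * (1 + eps))
  (fun n t => n%:R * t / (n%:R * (1 - n%:R * t) ^+ 3)).
Proof.
move=> k2; have [K hK] := ES_expansion_add k2; have [c c0 pc] := ppol_ge R k2.
have k3 : (2 * k = 3 + (2 * k - 3))%N by lia.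
exists (K / c) => n t n1 t0 tn d Omega P T Tt.
have n0 : 0 < n%:R :> R by rewrite ltr0n.
have nt1 : n%:R * t < 1.
  by rewrite -[ltRHS](@mulfV _ n%:R) ?gt_eqF // ltr_pM2l.
have [eps [epsK ->]] := hK n t n1 t0 tn d Omega P T Tt.
have x1 := xt_ge1 nt1 t0; have x0 := xt_gt0 nt1; have y0 := yt_gt0 nt1.
have px := pc _ x1.
move: epsK; rewrite div1r -/(xt n t).
set p := (ppol R k).[_] in px *; set x := xt n t in x0 x1 px *.
have p0 : 0 < p by apply: lt_le_trans px; rewrite mulr_gt0 ?exprn_gt0.
move=> epsK; exists (eps / (n%:R * p)); split; last first.
  by congr (_%:E); field; rewrite !gt_eqF.
rewrite normrM normfV [`|n%:R * p|]gtr0_norm ?mulr_gt0 //.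
rewrite ler_pdivrMr ?mulr_gt0 //; apply: (le_trans epsK).
(* The expansion does not record the sign of [K], but this product bounds an absolute value. *)
have KE0 : 0 <= K * (n%:R * t / (1 - n%:R * t) ^+ (2 * k)) by exact: le_trans epsK.
have E : n%:R * t / (1 - n%:R * t) ^+ (2 * k) = n%:R * t * x ^+ 3 * x ^+ (2 * k - 3).
  by rewrite -[RHS]mulrA -exprD /x /xt -exprVn -k3.
(* The last factor is at least 1 by the lower bound on p_k. *)
have -> : K / c * (n%:R * t / (n%:R * (1 - n%:R * t) ^+ 3)) * (n%:R * p) =
    K * (n%:R * t / (1 - n%:R * t) ^+ (2 * k)) * (p / (c * x ^+ (2 * k - 3))).
  rewrite E.
  have -> : 1 - n%:R * t = x^-1 by rewrite /x /xt invrK.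
  have : x ^+ (2 * k - 3) != 0 by rewrite expf_neq0 // gt_eqF.
  by move: (x ^+ (2 * k - 3)) => z z0; field; rewrite z0 !gt_eqF.
by rewrite ler_peMr // ler_pdivlMr ?mul1r // mulr_gt0 // exprn_gt0.
Qed.

End Process.

Theorem theorem3p4 (R : realType) :
  exists p q : nat -> {poly R},
    (forall k : nat, (2 <= k)%N ->
       size (p k) = (2 * k - 3).+1 /\
       ES_expansion k
         (fun n t eps => n%:R * (p k).[1 / (1 - n%:R * t)] + eps)
         (fun n t => n%:R * t / (1 - n%:R * t) ^+ (2 * k)) /\
       ES_expansion k
         (fun n t eps => n%:R * (p k).[1 / (1 - n%:R * t)] * (1 + eps))
         (fun n t => n%:R * t / (n%:R * (1 - n%:R * t) ^+ 3))) /\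
    p 2%N = 'X /\
    p 3%N = 'X^3 /\
    p 4%N = 3 *: 'X^5 - 2 *: 'X^4 /\
    ES_expansion (R := R) 3
      (fun n t eps => n%:R / (1 - n%:R * t) ^+ 3 * (1 + eps))
      (fun n t => n%:R * t / (n%:R * (1 - n%:R * t) ^+ 3)) /\
    ES_expansion (R := R) 4
      (fun n t eps =>
         n%:R * (3 - 2 * (1 - n%:R * t)) / (1 - n%:R * t) ^+ 5 * (1 + eps))
      (fun n t => n%:R * t / (n%:R * (1 - n%:R * t) ^+ 3)) /\
    (forall k : nat, (3 <= k)%N ->
       p k = 'X^k * q k /\ size (q k) = (k - 3).+1) /\
    (* each recursion holds and determines the polynomials *)
    q_recursion q /\
    (forall q' : nat -> {poly R}, q_recursion q' ->
       forall k : nat, (3 <= k)%N -> q' k = q k) /\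
    p_recursion p /\
    (forall p' : nat -> {poly R}, p_recursion p' ->
       forall k : nat, (2 <= k)%N -> p' k = p k).
Proof.
exists (@ppol R), (@qpol R); split.
  move=> k k2; split; first exact: size_ppol.
  by split; [exact: ES_expansion_add|exact: ES_expansion_mul].
split; first by [].
split; first exact: ppol3.
split; first exact: ppol4.
split.
  apply: ES_expansion_ext (ES_expansion_mul R (isT : (2 <= 3)%N)) => n t eps y0.
  by rewrite ppol3 hornerXn div1r exprVn.
split.
  apply: ES_expansion_ext (ES_expansion_mul R (isT : (2 <= 4)%N)) => n t eps y0.
  rewrite ppol4 hornerD hornerN !hornerZ !hornerXn; congr (_ * _).
  by field; rewrite gt_eqF.
split.
  by move=> k k3; rewrite ppolE // size_qpol.
split; first exact: qpol_rec.
split; first exact: q_recursion_uniq.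
by split; [exact: ppol_rec|exact: p_recursion_uniq].
Qed.
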